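(* Let $\sigma>0$, $a>0$, $\xi_0<\xi_1$, $\Delta=\xi_1-\xi_0$, $f(t)=e^{2\pi i\xi_0t}+ae^{2\pi i\xi_1t}$, and for $k\in\mathbb{Z}$ let $t_k^+=\frac{k}{\Delta}$ (constructive times) and $t_k^-=\frac{k+1/2}{\Delta}$ (destructive times). Let $M(\xi)=\min\{(\xi-\xi_0)^2,(\xi-\xi_1)^2\}$. Then the following piecewise asymptotics hold (as $\alpha\to0^+$): $$S_{V,f}^{(h)}(t_k^+,\xi)=\begin{cases}\Theta_{V,t_k^+}(\xi)+O(\alpha),&\xi\in(\xi_0,\xi_1),\\ O\left(\exp\left(-\frac{M(\xi)}{\alpha}\right)\right),&\xi\in(-\infty,\xi_0)\cup(\xi_1,\infty),\end{cases}$$ $$S_{V,f}^{(h)}(t_k^-,\xi)=\begin{cases}O\left(\exp\left(-\frac{M(\xi)}{\alpha}\right)\right),&\xi\in(\xi_0,\xi_1),\\ \Theta_{V,t_k^-}(\xi)+O(\alpha),&\xi\in(-\infty,\xi_0)\cup(\xi_1,\infty),\end{cases}$$ where $\Theta_{V,t}$ is the pushforward density defined in the context. Writing $u_*(\xi)=\frac{\xi-\xi_0}{\xi-\xi_1}$, we have $$\Theta_{V,t_k^+}(\xi)=\frac{e^{2\pi i\xi_0t_k^+}}{2\pi^2\sigma^2}\frac{A_+(\xi)}{(\xi-\xi_0)(\xi-\xi_1)}\quad\text{for }\xi\in(\xi_0,\xi_1),$$ $$\Theta_{V,t_k^-}(\xi)=-\frac{e^{2\pi i\xi_0t_k^-}}{2\pi^2\sigma^2}\frac{A_-(\xi)}{(\xi-\xi_0)(\xi-\xi_1)}\quad\text{for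 }\xi\in(-\infty,\xi_0)\cup(\xi_1,\infty),$$ and $\Theta_{V,t_k^\pm}(\xi)=0$ outside the specified intervals, where $$A_+(\xi)=\left(1-u_*(\xi)\right)\exp\left(-\frac{\pi^2\sigma^2\Delta^2}{4}\right)\left(-\frac{a}{u_*(\xi)}\right)^{1/2}\exp\left(-\frac{\left[\ln\left(-\frac{u_*(\xi)}{a}\right)\right]^2}{4\pi^2\sigma^2\Delta^2}\right),$$ $$A_-(\xi)=\left|1-u_*(\xi)\right|\exp\left(-\frac{\pi^2\sigma^2\Delta^2}{4}\right)\left(\frac{a}{u_*(\xi)}\right)^{1/2}\exp\left(-\frac{\left[\ln\left(\frac{u_*(\xi)}{a}\right)\right]^2}{4\pi^2\sigma^2\Delta^2}\right).$$
   Context: The window is the Gaussian $h(x)=\frac{1}{\sigma\sqrt{\pi}}e^{-x^2/\sigma^2}$, and $V_f^{(h)}(t,\eta)=\int_{-\infty}^\infty f(x)h(x-t)e^{-2\pi i\eta(x-t)}dx=e^{2\pi i\xi_0t}\left(e^{-\pi^2\sigma^2(\eta-\xi_0)^2}+ae^{2\pi i\Delta t}e^{-\pi^2\sigma^2(\eta-\xi_1)^2}\right)$. The synchrosqueezing reassignment rule is $\hat\eta_s(t,\eta)=\frac{1}{2\pi i}\frac{\partial_tV_f^{(h)}(t,\eta)}{V_f^{(h)}(t,\eta)}$ if $V_f^{(h)}(t,\eta)\ne0$, and $-\infty$ otherwise. The mollifier is $g_\alpha(z)=\frac{1}{\sqrt{\pi\alpha}}e^{-|z|^2/\alpha}$ for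 $z\in\mathbb{C}$, with small $\alpha>0$. The standard STFT-based synchrosqueezing transform is $$S_{V,f}^{(h)}(t,\xi)=\int_{-\infty}^\infty V_f^{(h)}(t,\eta)\,g_\alpha\left(\hat\eta_s(t,\eta)-\xi\right)d\eta.$$ For fixed $t$, the pushforward density $\Theta_{V,t}$ is the density of the pushforward of the complex measure $V_f^{(h)}(t,\eta)\,d\eta$ under $\eta\mapsto\hat\eta_s(t,\eta)$: for real $\xi$ such that $\hat\eta_s(t,\eta)=\xi$ has finitely many regular solutions $\eta_j$, $$\Theta_{V,t}(\xi)=\sum_{\hat\eta_s(t,\eta_j)=\xi}\frac{V_f^{(h)}(t,\eta_j)}{|\partial_\eta\hat\eta_s(t,\eta_j)|}$$ on the support set, and $\Theta_{V,t}(\xi)=0$ off the support.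
   Formalization: Signs of two closed forms corrected, as the printed ones contradict the definition of Θ: for t_k^+ on (ξ0,ξ1) a leading minus is added, and for t_k^- on (-∞,ξ0) the leading minus is removed; the formula for t_k^- on (ξ1,∞) is as printed. *)

(* Defs.v *)
(* MathComp / MathComp-Analysis, with complex numbers R[i] from
   mathcomp-real-closed. *)
From HB Require Import structures.
From mathcomp Require Import all_boot all_order all_algebra.
From mathcomp Require Import complex.
From mathcomp Require Import all_classical all_reals all_analysis.

Set Implicit Arguments.
Unset Strict Implicit.
Unset Printing Implicit Defensive.

Import Order.TTheory GRing.Theory Num.Theory.
Import numFieldNormedType.Exports.

Local Open Scope classical_set_scope.
Local Open Scope ring_scope.
Local Open Scope complex_scope.

(* e^{i x} for real x *)
Definition expi (R : realType) (x : R) : R[i] := cos x +i* sin x.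

(* Integration and differentiation of complex-valued functions of a real
   variable are taken on real and imaginary parts. *)
Definition cintegral (R : realType) (F : R -> R[i]) : R[i] :=
  (\int[@lebesgue_measure R]_x complex.Re (F x)) +i*
  (\int[@lebesgue_measure R]_x complex.Im (F x)).

Definition cderivable (R : realType) (F : R -> R[i]) (x : R) : Prop :=
  derivable (fun y => complex.Re (F y)) x 1 /\
  derivable (fun y => complex.Im (F y)) x 1.

Definition cderive (R : realType) (F : R -> R[i]) (x : R) : R[i] :=
  derive1 (fun y => complex.Re (F y)) x +i*
  derive1 (fun y => complex.Im (F y)) x.

Definition gauss_window (R : realType) (sigma x : R) : R :=
  (sigma * Num.sqrt pi)^-1 * expR (- (x ^+ 2 / sigma ^+ 2)).

Definition two_tone (R : realType) (a xi0 xi1 t : R) : R[i] :=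
  expi (2 * pi * xi0 * t) + a%:C * expi (2 * pi * xi1 * t).

Definition stft (R : realType) (h : R -> R) (f : R -> R[i]) (t eta : R)
    : R[i] :=
  cintegral (fun x => f x * (h (x - t))%:C * expi (- (2 * pi * eta * (x - t)))).

(* The quotient (1 / (2 pi i)) (d/dt V) / V; meaningful only where V != 0. *)
Definition reassign_quot (R : realType) (V : R -> R -> R[i]) (t eta : R)
    : R[i] :=
  ((2 * pi)%:C * 'i)^-1 * (cderive (fun s => V s eta) t / V t eta).

(* None stands for the value -oo of the rule at the zeros of V. *)
Definition reassign (R : realType) (V : R -> R -> R[i]) (t eta : R)
    : option R[i] :=
  if V t eta != 0 then Some (reassign_quot V t eta) else None.

Definition mollifier (R : realType) (alpha : R) (z : R[i]) : R :=
  (Num.sqrt (pi * alpha))^-1 * expR (- (ComplexField.Normc.normc z ^+ 2 / alpha)).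

(* mollifier alpha (w - xi), with value 0 when w = -oo *)
Definition mollifier_at (R : realType) (alpha : R) (w : option R[i]) (xi : R)
    : R :=
  if w is Some z then mollifier alpha (z - xi%:C) else 0.

Definition sst (R : realType) (V : R -> R -> R[i]) (alpha t xi : R) : R[i] :=
  cintegral (fun eta => V t eta * (mollifier_at alpha (reassign V t eta) xi)%:C).

Definition reassign_fiber (R : realType) (V : R -> R -> R[i]) (t xi : R)
    : set R :=
  [set eta | reassign V t eta = Some xi%:C].

(* The equation [reassign V t eta = xi] has finitely many solutions, all of
   them regular: this is the domain on which pushforward_density is defined. *)
Definition regular_value (R : realType) (V : R -> R -> R[i]) (t xi : R)
    : Prop :=
  finite_set (reassign_fiber V t xi) /\
  forall eta, reassign_fiber V t xi eta ->
    cderivable (reassign_quot V t) eta /\ cderive (reassign_quot V t) eta != 0.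

(* Density at xi of the image of the complex measure V(t, eta) d eta under
   eta |-> reassign V t eta; the sum is 0 when the fiber is empty. *)
Definition pushforward_density (R : realType) (V : R -> R -> R[i]) (t xi : R)
    : R[i] :=
  \sum_(eta \in reassign_fiber V t xi)
    (V t eta / (ComplexField.Normc.normc (cderive (reassign_quot V t) eta))%:C).

Definition two_tone_stft (R : realType) (sigma a xi0 xi1 : R)
    : R -> R -> R[i] :=
  stft (gauss_window sigma) (two_tone a xi0 xi1).

Definition t_plus (R : realType) (xi0 xi1 : R) (k : int) : R :=
  k%:~R / (xi1 - xi0).

Definition t_minus (R : realType) (xi0 xi1 : R) (k : int) : R :=
  (k%:~R + 2^-1) / (xi1 - xi0).

Definition M_dist (R : realType) (xi0 xi1 xi : R) : R :=
  Num.min ((xi - xi0) ^+ 2) ((xi - xi1) ^+ 2).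

Definition u_star (R : realType) (xi0 xi1 xi : R) : R :=
  (xi - xi0) / (xi - xi1).

Definition A_plus (R : realType) (sigma a xi0 xi1 xi : R) : R :=
  let u := u_star xi0 xi1 xi in
  (1 - u) * expR (- (pi ^+ 2 * sigma ^+ 2 * (xi1 - xi0) ^+ 2 / 4))
  * Num.sqrt (- (a / u))
  * expR (- (ln (- (u / a)) ^+ 2
             / (4 * pi ^+ 2 * sigma ^+ 2 * (xi1 - xi0) ^+ 2))).

Definition A_minus (R : realType) (sigma a xi0 xi1 xi : R) : R :=
  let u := u_star xi0 xi1 xi in
  `|1 - u| * expR (- (pi ^+ 2 * sigma ^+ 2 * (xi1 - xi0) ^+ 2 / 4))
  * Num.sqrt (a / u)
  * expR (- (ln (u / a) ^+ 2
             / (4 * pi ^+ 2 * sigma ^+ 2 * (xi1 - xi0) ^+ 2))).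

(* (xi - xi0) (xi - xi1) is negative on (xi0, xi1), where A_plus > 0, and
   positive outside, where A_minus > 0.  At a solution of reassign V t eta = xi,
   e^{-2 pi i xi0 t} V(t, eta) has the sign of 1 - u_star xi0 xi1 xi: positive
   for xi < xi1, negative for xi > xi1.  Hence the density is - density_form on
   (xi0, xi1) and on (xi1, +oo), and + density_form on (-oo, xi0). *)
Definition density_form (R : realType) (sigma xi0 xi1 t A xi : R) : R[i] :=
  expi (2 * pi * xi0 * t) / (2 * pi ^+ 2 * sigma ^+ 2)%:C
  * (A / ((xi - xi0) * (xi - xi1)))%:C.

(* F alpha = O(G alpha) as alpha -> 0+, for complex-valued F and real G *)
Definition cbigO (R : realType) (F : R -> R[i]) (G : R -> R) : Prop :=
  (fun alpha => ComplexField.Normc.normc (F alpha)) =O_ (0^'+) G.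

(* Main.v *)
Require Import Defs.
From HB Require Import structures.
From mathcomp Require Import all_boot all_order all_algebra.
From mathcomp Require Import complex ring lra.
From mathcomp Require Import all_classical all_reals all_analysis.
From mathcomp Require Import measurable_realfun.

Set Implicit Arguments.
Unset Strict Implicit.
Unset Printing Implicit Defensive.

Import Order.TTheory GRing.Theory Num.Theory.
Import numFieldNormedType.Exports.

Local Open Scope classical_set_scope.
Local Open Scope ring_scope.
Local Open Scope complex_scope.

(** At a constructive or destructive time the two tones of the signal are
    aligned: e^{2 pi i xi1 t} = eps e^{2 pi i xi0 t} with eps = 1 or eps = -1.
    Put b = pi^2 sigma^2 and D = xi1 - xi0, let G(eta) = exp (- b (eta - xi0)^2)
    and let rho(eta) = a exp (2 b D (eta - (xi0 + xi1) / 2)) be the ratio of the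
    moduli of the two tones in the transform.  The Fourier transform of the
    Gaussian gives V(t, eta) = e^{2 pi i xi0 t} G (1 + eps rho), and the
    reassignment rule becomes the real Moebius function
    eta^ = (xi0 + eps rho xi1) / (1 + eps rho) of rho, which satisfies the
    logistic equation d eta^ / d eta = - 2 b (eta^ - xi0) (eta^ - xi1).

    It has an explicit inverse [freq_inv], defined exactly where - eps u_* > 0:
    on (xi0, xi1) for eps = 1, where eta^ increases along the whole line, and
    outside [xi0, xi1] for eps = -1, where eta^ decreases along each of the two
    half-lines cut out by rho = 1.  So a fiber has at most one point, the
    derivative does not vanish there, and evaluating V / |d eta^ / d eta| at
    [freq_inv] gives the closed form of the density ([tone_profile_freq_inv],
    [density_inside], [density_outside]).

    The change of variables s = eta^(eta) on each monotone branch
    ([integral_substitution], [sst_piece]) turns the synchrosqueezing transform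
    into the convolution of this density, restricted to the image of the branch,
    with the Gaussian kernel of variance alpha / 2.  The density is bounded,
    because G (1 + rho)^3 / rho is a combination of Gaussians in eta
    ([density_bounded]), and it has a second-order expansion at each point of
    its support ([density_second_order]).
    - If xi lies in the image of the branch, the constant term of the expansion
      is reproduced, the linear term is killed by symmetry, and the quadratic
      remainder, valid globally by boundedness, contributes at most a multiple
      of the second moment O(alpha) of the kernel ([gauss_kernel_smoothing]).
    - Otherwise let p be the endpoint of the image nearest to xi.  Every s in
      the image satisfies (s - xi)^2 >= (p - xi)^2 + (s - p)^2, so the kernel
      at xi is at most exp (- (p - xi)^2 / alpha) times the kernel at p, whose
      integral is 1.  This yields the exponential rate without the loss
      alpha^{-1/2} of a bound by the supremum ([gauss_kernel_tail]).
    For eps = -1 the two branches add up: the one that misses xi is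
    exponentially small, hence also O(alpha). *)

(** * Integrals over the real line and the Gaussian kernel *)

Section improper.
Variable R : realType.
Implicit Types f g F : R -> R.
Local Notation mu := (@lebesgue_measure R).

Lemma normr_le_nat (x : R) : exists n : nat, `|x| <= n%:R.
Proof. exists (Num.truncn `|x|).+1; apply: ltW; exact: truncnS_gt. Qed.

Lemma integrable_EFinZ (k : R) f : mu.-integrable setT (EFin \o f) ->
  mu.-integrable setT (EFin \o (fun x => k * f x)).
Proof.
move=> fi; rewrite [X in _.-integrable _ X](_ : _ =
  fun x => k%:E * (EFin \o f) x)%E//.
exact: integrableZl.
Qed.

Lemma integrable_EFinB f g : mu.-integrable setT (EFin \o f) ->
  mu.-integrable setT (EFin \o g) ->
  mu.-integrable setT (EFin \o (fun x => f x - g x)).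
Proof.
move=> fi gi; rewrite [X in _.-integrable _ X](_ : _ =
  (EFin \o f) \- (EFin \o g))%E//.
exact: integrableB.
Qed.

(** Dominated convergence, the integrand itself being the dominating function. *)
Lemma cvg_integral_symitv f : mu.-integrable setT (EFin \o f) ->
  \int[mu]_(x in `[- n%:R, n%:R]) f x @[n --> \oo] --> \int[mu]_x f x.
Proof.
move=> fi.
have mf : measurable_fun setT f by move/measurable_int: fi => /measurable_EFinP.
pose fn (n : nat) x := ((EFin \o f) \_ `[- n%:R, n%:R]) x.
have mfn n : measurable_fun setT (fn n).
  apply/(measurable_restrictT _ _).1 => //.
  by apply/measurable_EFinP; exact: measurable_funTS.
have cvfn : {ae mu, forall x, setT x -> fn n x @[n --> \oo] --> (EFin \o f) x}.
  apply: aeW => x _; apply: cvg_near_cst.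
  have [N xN] := normr_le_nat x.
  exists N => // n /= Nn; rewrite /fn patchE ifT// inE/= in_itv/= -ler_norml.
  by rewrite (le_trans xN)// ler_nat.
have dom : {ae mu, forall x n, setT x -> (`|fn n x| <= `|(EFin \o f) x|)%E}.
  by apply: aeW => x n _; rewrite /fn patchE; case: ifP => // _; rewrite abse0.
have ig : mu.-integrable setT (fun x => `|(EFin \o f) x|%E).
  exact: integrable_abse.
have [_ _ lim] := @dominated_convergence _ _ _ mu _ measurableT _ _ _ mfn
  (measurable_int _ fi) cvfn ig dom.
apply: fine_cvg; rewrite fineK; last exact: integrable_fin_num.
rewrite [X in X @ _ --> _](_ : _ = fun n => \int[mu]_x fn n x)%E//.
by apply/funext => n; rewrite integral_mkcond.
Qed.

(** The fundamental theorem of calculus on [-n, n], in the limit.  It stands in for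
    integration by parts on the whole line. *)
Lemma Rintegral_derivative_vanishing f F :
  continuous f -> mu.-integrable setT (EFin \o f) ->
  (forall x : R, is_derive x (1 : R) F (f x)) ->
  F n%:R @[n --> \oo] --> (0 : R) -> F (- n%:R) @[n --> \oo] --> (0 : R) ->
  \int[mu]_x f x = 0.
Proof.
move=> cf fi dF Fy FNy.
apply/esym/(cvg_unique _ _ (cvg_integral_symitv fi)) => //.
have : F n%:R - F (- n%:R) @[n --> \oo] --> (0 - 0 : R) by exact: cvgB.
rewrite subrr; apply: cvg_trans; apply: near_eq_cvg; near=> n.
rewrite /Rintegral (@continuous_FTC2 _ f F)//.
- by rewrite ltrNl (@lt_le_trans _ _ 0) ?oppr_lt0 ?ltr0n//; near: n; exact: nbhs_infty_gt.
- exact: continuous_subspaceT.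
- have cF : continuous F.
    by move=> x; apply/differentiable_continuous/derivable1_diffP; case: (dF x).
  split => //.
  + by apply/cvg_at_right_filter/cF.
  + by apply/cvg_at_left_filter/cF.
- by move=> x _; rewrite derive1E; case: (dF x).
Unshelve. all: end_near. Qed.

End improper.

Section gauss_kernel.
Variable R : realType.
Implicit Types alpha m x : R.
Local Notation mu := (@lebesgue_measure R).

(** The normal density of mean m and variance alpha / 2; both the mollifier on
    the real axis and the window (for alpha = sigma^2) have this form. *)
Definition gauss_kernel alpha m x : R :=
  (Num.sqrt (pi * alpha))^-1 * expR (- ((x - m) ^+ 2 / alpha)).

Lemma gauss_kernelE alpha m : 0 < alpha ->
  gauss_kernel alpha m = normal_pdf m (Num.sqrt (alpha / 2)).
Proof.
move=> a0; have a20 : 0 < alpha / 2 by rewrite divr_gt0.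
rewrite normal_pdfE ?gt_eqF ?sqrtr_gt0//; apply/funext => x.
rewrite /normal_peak /normal_fun /gauss_kernel sqr_sqrtr ?ltW//.
by congr (_ * expR _); [congr (Num.sqrt _)^-1|]; field; rewrite ?gt_eqF.
Qed.

Lemma gauss_kernel_ge0 alpha m x : 0 <= gauss_kernel alpha m x.
Proof. by rewrite mulr_ge0 ?expR_ge0// invr_ge0. Qed.

Lemma gauss_kernel_le alpha m x : 0 < alpha ->
  gauss_kernel alpha m x <= (Num.sqrt (pi * alpha))^-1.
Proof.
move=> a0; rewrite ler_piMr ?invr_ge0// -[leRHS]expR0 ler_expR oppr_le0.
by rewrite divr_ge0 ?sqr_ge0 ?ltW.
Qed.

Lemma continuous_gauss_kernel alpha m : 0 < alpha ->
  continuous (gauss_kernel alpha m).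
Proof.
move=> a0; rewrite gauss_kernelE//; apply: continuous_normal_pdf.
by rewrite gt_eqF// sqrtr_gt0 divr_gt0.
Qed.

Lemma measurable_gauss_kernel alpha m D : measurable D -> 0 < alpha ->
  measurable_fun D (gauss_kernel alpha m).
Proof.
move=> mD a0; apply: measurable_funTS; apply: continuous_measurable_fun.
exact: continuous_gauss_kernel.
Qed.

Lemma integral_gauss_kernel alpha m : 0 < alpha ->
  (\int[mu]_x (gauss_kernel alpha m x)%:E = 1)%E.
Proof. by move=> a0; rewrite gauss_kernelE//; exact: integral_normal_pdf. Qed.

Lemma integrable_gauss_kernel alpha m : 0 < alpha ->
  mu.-integrable setT (EFin \o gauss_kernel alpha m).
Proof. by move=> a0; rewrite gauss_kernelE//; exact: integrable_normal_pdf. Qed.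

Lemma Rintegral_gauss_kernel alpha m : 0 < alpha ->
  \int[mu]_x gauss_kernel alpha m x = 1.
Proof. by move=> a0; rewrite /Rintegral integral_gauss_kernel. Qed.

Lemma is_derive_gauss_kernel alpha m x : 0 < alpha ->
  is_derive x (1 : R) (gauss_kernel alpha m)
    (- (2 * (x - m) / alpha) * gauss_kernel alpha m x).
Proof.
move=> a0; rewrite /gauss_kernel.
apply: is_derive_eq; rewrite /GRing.scale/=.
by field; rewrite !gt_eqF ?sqrtr_gt0 ?mulr_gt0 ?pi_gt0.
Qed.

(** The inequality y exp (- 2 y) <= exp (- y) at y = (x - m)^2 / (2 alpha): the
    quadratic factor is absorbed by doubling the variance, which bounds the second
    moment without computing it. *)
Lemma sqr_gauss_kernel_le alpha m x : 0 < alpha ->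
  (x - m) ^+ 2 * gauss_kernel alpha m x <= 4 * alpha * gauss_kernel (2 * alpha) m x.
Proof.
move=> a0; set y := (x - m) ^+ 2 / (2 * alpha).
have a20 : 0 < 2 * alpha by rewrite mulr_gt0.
have xE : (x - m) ^+ 2 = 2 * alpha * y by rewrite /y mulrC divfK ?gt_eqF.
have y0 : 0 <= y by rewrite divr_ge0 ?sqr_ge0 ?ltW.
rewrite /gauss_kernel -/y {2}xE.
have -> : 2 * alpha * y / alpha = y + y by field; rewrite gt_eqF.
rewrite opprD expRD xE.
have s0 : 0 < Num.sqrt (pi * alpha) by rewrite sqrtr_gt0 mulr_gt0 ?pi_gt0.
have -> : Num.sqrt (pi * (2 * alpha)) = Num.sqrt 2 * Num.sqrt (pi * alpha).
  by rewrite mulrCA sqrtrM.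
have s2 : 0 < Num.sqrt (2 : R) by rewrite sqrtr_gt0.
have s22 : Num.sqrt (2 : R) <= 2.
  by rewrite -[leRHS](@ger0_norm _ 2)// -sqrtr_sqr ler_sqrt ?sqr_ge0// expr2 -natrM ler_nat.
have ye : y * expR (- y) <= 1.
  rewrite expRN ler_pdivrMr ?expR_gt0// mul1r (le_trans _ (expR_ge1Dx _))//.
  by rewrite lerDr.
have e0 : 0 <= expR (- y) by exact: expR_ge0.
rewrite invfM.
have -> : 2 * alpha * y * ((Num.sqrt (pi * alpha))^-1 * (expR (- y) * expR (- y)))
  = (2 * alpha * (Num.sqrt (pi * alpha))^-1 * expR (- y)) * (y * expR (- y)) by ring.
have -> : 4 * alpha * ((Num.sqrt 2)^-1 / Num.sqrt (pi * alpha) * expR (- y)) =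
  (2 * alpha * (Num.sqrt (pi * alpha))^-1 * expR (- y)) * (2 / Num.sqrt 2).
  by field; rewrite !gt_eqF.
rewrite ler_wpM2l//; first by rewrite !mulr_ge0 ?invr_ge0 ?ltW ?expR_gt0.
by rewrite (le_trans ye)// ler_pdivlMr// mul1r.
Qed.

Lemma integrable_sqr_gauss_kernel alpha m : 0 < alpha ->
  mu.-integrable setT (EFin \o (fun x => (x - m) ^+ 2 * gauss_kernel alpha m x)).
Proof.
move=> a0; have a20 : 0 < 2 * alpha by rewrite mulr_gt0.
apply: (@le_integrable _ _ _ mu _ _ _
  (EFin \o (fun x => 4 * alpha * gauss_kernel (2 * alpha) m x))) => //.
- apply/measurable_EFinP/measurable_funM; last exact: measurable_gauss_kernel.
  by apply: measurable_funX; exact: measurable_funB.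
- move=> x _ /=; rewrite lee_fin [leLHS]ger0_norm ?(mulr_ge0 (sqr_ge0 _)) ?gauss_kernel_ge0//.
  rewrite [leRHS]ger0_norm ?mulr_ge0 ?gauss_kernel_ge0 ?(ltW a0)//.
  exact: sqr_gauss_kernel_le.
- by apply: integrable_EFinZ; exact: integrable_gauss_kernel.
Qed.

Lemma Rintegral_sqr_gauss_kernel_le alpha m : 0 < alpha ->
  \int[mu]_x ((x - m) ^+ 2 * gauss_kernel alpha m x) <= 4 * alpha.
Proof.
move=> a0; have a20 : 0 < 2 * alpha by rewrite mulr_gt0.
rewrite -[leRHS]mulr1 -[X in _ <= _ * X](@Rintegral_gauss_kernel (2 * alpha) m)//.
rewrite -RintegralZl//; last exact: integrable_gauss_kernel.
apply: le_Rintegral => //=.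
- exact: integrable_sqr_gauss_kernel.
- by apply: integrable_EFinZ; exact: integrable_gauss_kernel.
- by move=> x _; exact: sqr_gauss_kernel_le.
Qed.

Lemma integrable_id_gauss_kernel alpha m : 0 < alpha ->
  mu.-integrable setT (EFin \o (fun x => (x - m) * gauss_kernel alpha m x)).
Proof.
move=> a0.
pose g1 := EFin \o gauss_kernel alpha m.
pose g2 := EFin \o (fun x => (x - m) ^+ 2 * gauss_kernel alpha m x).
apply: (@le_integrable _ _ _ mu _ _ _ (g1 \+ g2)%E) => //.
- apply/measurable_EFinP/measurable_funM; last exact: measurable_gauss_kernel.
  exact: measurable_funB.
- move=> x _ /=; rewrite lee_fin -{2}[gauss_kernel alpha m x]mul1r -mulrDl.
  rewrite !normrM ler_wpM2r//.
  rewrite [leRHS]ger0_norm ?addr_ge0 ?sqr_ge0// -real_normK ?num_real//.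
  have := normr_ge0 (x - m); nra.
- apply: integrableD => //; first exact: integrable_gauss_kernel.
  exact: integrable_sqr_gauss_kernel.
Qed.

Lemma cvg_gauss_kernel_y alpha m : 0 < alpha ->
  gauss_kernel alpha m n%:R @[n --> \oo] --> (0 : R).
Proof.
move=> a0; rewrite -(mulr0 (Num.sqrt (pi * alpha))^-1).
apply: cvgMl_tmp.
apply: (@cvg_comp _ _ _ (fun n : nat => (n%:R - m) ^+ 2 / alpha)
  (fun x => expR (- x))); last first.
  exact: cvgr_expR.
apply/cvgryPge => A; near=> n.
have : m + 1 + `|A| * alpha <= n%:R.
  by near: n; exact: nbhs_infty_ger.
have := ler_norm A; have : 0 <= `|A| * alpha by rewrite mulr_ge0// ltW.
rewrite ler_pdivlMr//; move: `|A| => B; nra.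
Unshelve. all: end_near. Qed.

Lemma cvg_gauss_kernel_Ny alpha m : 0 < alpha ->
  gauss_kernel alpha m (- n%:R) @[n --> \oo] --> (0 : R).
Proof.
move=> a0; have -> : (fun n => gauss_kernel alpha m (- n%:R)) =
    (fun n : nat => gauss_kernel alpha (- m) n%:R).
  by apply/funext => n; rewrite /gauss_kernel opprK -(sqrrN (- _ - _)) opprB opprK (addrC m).
exact: cvg_gauss_kernel_y.
Qed.

(** The integrand is the derivative of - (alpha / 2) times the kernel. *)
Lemma Rintegral_id_gauss_kernel alpha m : 0 < alpha ->
  \int[mu]_x ((x - m) * gauss_kernel alpha m x) = 0.
Proof.
move=> a0.
apply: (@Rintegral_derivative_vanishing _ _ (fun x => - (alpha / 2) * gauss_kernel alpha m x)).
- move=> x; apply: cvgM; last exact: continuous_gauss_kernel.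
  by apply: cvgB => //; exact: cvg_cst.
- exact: integrable_id_gauss_kernel.
- move=> x; have := is_derive_gauss_kernel m x a0 => dg.
  apply: is_derive_eq; rewrite /GRing.scale/=.
  by field; rewrite gt_eqF.
- by rewrite -(mulr0 (- (alpha / 2))); apply: cvgMl_tmp; exact: cvg_gauss_kernel_y.
- by rewrite -(mulr0 (- (alpha / 2))); apply: cvgMl_tmp; exact: cvg_gauss_kernel_Ny.
Qed.

End gauss_kernel.

(** * The short-time Fourier transform of two tones *)

Section fourier.
Variable R : realType.
Local Notation mu := (@lebesgue_measure R).

Lemma integrable_bounded_mul (p q : R -> R) : measurable_fun setT p ->
  (forall x, `|p x| <= 1) -> mu.-integrable setT (EFin \o q) ->
  mu.-integrable setT (EFin \o (fun x => p x * q x)).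
Proof.
move=> mp p1 iq; apply: (le_integrable _ _ _ iq) => //.
  apply/measurable_EFinP/measurable_funM => //.
  by move/measurable_int : iq => /measurable_EFinP.
by move=> x _ /=; rewrite lee_fin normrM ler_piMl.
Qed.

Variables (s2 m c : R).
Hypothesis s20 : 0 < s2.
Local Notation g := (gauss_kernel s2 m).

Let phase (w x : R) := w * (x - m) + c.

Let continuous_phase w : continuous (phase w).
Proof.
move=> x; apply: cvgD; last exact: cvg_cst.
by apply: cvgMl_tmp; apply: cvgB => //; exact: cvg_cst.
Qed.

Let measurable_cosp w : measurable_fun setT (fun x => cos (phase w x)).
Proof.
apply: continuous_measurable_fun => x.
by apply: continuous_comp; [exact: continuous_phase|exact: continuous_cos].
Qed.

Let measurable_sinp w : measurable_fun setT (fun x => sin (phase w x)).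
Proof.
apply: continuous_measurable_fun => x.
by apply: continuous_comp; [exact: continuous_phase|exact: continuous_sin].
Qed.

Let cos_le1 w x : `|cos (phase w x)| <= 1.
Proof. by rewrite ler_norml cos_geN1 cos_le1. Qed.

Let sin_le1 w x : `|sin (phase w x)| <= 1.
Proof. by rewrite ler_norml sin_geN1 sin_le1. Qed.

Let F w := \int[mu]_x (cos (phase w x) * g x).

Lemma integrable_cos_gauss_kernel w :
  mu.-integrable setT (EFin \o (fun x => cos (w * (x - m) + c) * g x)).
Proof.
apply: (@integrable_bounded_mul (fun x => cos (phase w x)) g) => //.
exact: integrable_gauss_kernel.
Qed.

Let integrable_sin w :
  mu.-integrable setT (EFin \o (fun x => sin (phase w x) * ((x - m) * g x))).
Proof.
by apply: integrable_bounded_mul => //; exact: integrable_id_gauss_kernel.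
Qed.

Let is_derive_fw w x :
  is_derive w (1 : R) (fun w => cos (phase w x) * g x)
    (- (sin (phase w x) * ((x - m) * g x))).
Proof. by rewrite /phase; apply: is_derive_eq; rewrite /GRing.scale/=; ring. Qed.

(** The integral of the derivative of sin (w (x - m) + c) g(x) vanishes; expanding
    that derivative gives the identity. *)
Let int_parts w : \int[mu]_x (sin (phase w x) * ((x - m) * g x)) = s2 / 2 * w * F w.
Proof.
pose h1 x := w * (cos (phase w x) * g x).
pose h2 x := 2 / s2 * (sin (phase w x) * ((x - m) * g x)).
have i1 : mu.-integrable setT (EFin \o h1).
  by apply: integrable_EFinZ; exact: integrable_cos_gauss_kernel.
have i2 : mu.-integrable setT (EFin \o h2).
  by apply: integrable_EFinZ; exact: integrable_sin.
have : \int[mu]_x (h1 x - h2 x) = 0.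
  apply: (@Rintegral_derivative_vanishing _ _ (fun x => sin (phase w x) * g x)).
  - move=> x; apply: cvgB; apply: cvgMl_tmp.
      apply: cvgM; last exact: continuous_gauss_kernel.
      by apply: continuous_comp; [exact: continuous_phase|exact: continuous_cos].
    apply: cvgM.
      by apply: continuous_comp; [exact: continuous_phase|exact: continuous_sin].
    apply: cvgM; last exact: continuous_gauss_kernel.
    by apply: cvgB => //; exact: cvg_cst.
  - exact: integrable_EFinB.
  - move=> x; have := is_derive_gauss_kernel m x s20 => dg.
    rewrite /phase; apply: is_derive_eq; rewrite /h1 /h2 /phase /GRing.scale/=.
    by field; rewrite gt_eqF.
  - have b n : `|sin (phase w n%:R) * g n%:R| <= g n%:R.
      by rewrite normrM [X in _ * X]ger0_norm ?gauss_kernel_ge0// ler_piMl// gauss_kernel_ge0.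
    apply: norm_cvg0; apply: (@squeeze_cvgr _ _ _ _ (cst 0) (fun n => g n%:R)).
    + by near=> n; rewrite normr_ge0 b.
    + exact: cvg_cst.
    + exact: cvg_gauss_kernel_y.
  - have b n : `|sin (phase w (- n%:R)) * g (- n%:R)| <= g (- n%:R).
      by rewrite normrM [X in _ * X]ger0_norm ?gauss_kernel_ge0// ler_piMl// gauss_kernel_ge0.
    apply: norm_cvg0; apply: (@squeeze_cvgr _ _ _ _ (cst 0) (fun n => g (- n%:R))).
    + by near=> n; rewrite normr_ge0 b.
    + exact: cvg_cst.
    + exact: cvg_gauss_kernel_Ny.
rewrite RintegralB// /h1 /h2 !RintegralZl//; last exact: integrable_cos_gauss_kernel.
rewrite -/(F w) => /eqP; rewrite subr_eq0 => /eqP E.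
have -> : s2 / 2 * w * F w = s2 / 2 * (w * F w) by ring.
by rewrite E; field; rewrite gt_eqF.
Unshelve. all: end_near. Qed.

(** Differentiation under the integral sign, dominated by |x - m| g(x) uniformly in w. *)
Let is_derive_F w : is_derive w (1 : R) F (- (s2 / 2 * w * F w)).
Proof.
have Iw : (`]w - 1, w + 1[%classic : set R) w.
  by rewrite /= in_itv/= ltrBlDr !ltrDl ltr01.
have d1 v x : partial1of2 (fun w x => cos (phase w x) * g x) v x =
    - (sin (phase v x) * ((x - m) * g x)).
  by rewrite partial1of2E; exact: derive_val.
have iG : mu.-integrable setT (EFin \o (fun x => `|(x - m) * g x|)).
  by apply: integrable_norm; exact: integrable_id_gauss_kernel.
have iF v : (`]w - 1, w + 1[%classic : set R) v ->
    mu.-integrable setT (EFin \o (fun x => cos (phase v x) * g x)).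
  by move=> _; exact: integrable_cos_gauss_kernel.
have df v x : (`]w - 1, w + 1[%classic : set R) v -> setT x ->
    derivable ((fun w x => cos (phase w x) * g x) ^~ x) v 1.
  by move=> _ _; case: (is_derive_fw v x).
have ub v x : (`]w - 1, w + 1[%classic : set R) v -> setT x ->
    `|partial1of2 (fun w x => cos (phase w x) * g x) v x| <= `|(x - m) * g x|.
  by move=> _ _; rewrite d1 normrN normrM ler_piMl.
have G0 x : 0 <= `|(x - m) * g x| by [].
have dF := @derivable_under_integral R _ _ mu (fun w x => cos (phase w x) * g x)
  setT measurableT w _ _ Iw iF df _ G0 iG ub.
have eF := @differentiation_under_integral R _ _ mu (fun w x => cos (phase w x) * g x)
  setT measurableT w _ _ Iw iF df _ G0 iG ub.
apply: DeriveDef => //; rewrite -derive1E eF.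
rewrite -int_parts.
under eq_Rintegral do rewrite d1 -mulN1r.
by rewrite RintegralZl ?mulN1r//; exact: integrable_sin.
Qed.

(** As a function of w the integral F satisfies F' = - (s2 / 2) w F, so
    F exp (s2 w^2 / 4) is constant.  The phase c handles cosine and sine at once,
    and centering at m avoids a translation of the integral. *)
Lemma fourier_gauss_kernel w :
  \int[mu]_x (cos (w * (x - m) + c) * g x) = cos c * expR (- (s2 * w ^+ 2 / 4)).
Proof.
rewrite -/(F w).
have E : F w * expR (s2 * w ^+ 2 / 4) = F 0 * expR (s2 * 0 ^+ 2 / 4).
  apply: (@is_derive_0_is_cst _ (fun w => F w * expR (s2 * w ^+ 2 / 4))) => v.
  have := is_derive_F v => dF; apply: is_derive_eq; rewrite /GRing.scale/=.
  by field.
have F0 : F 0 = cos c.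
  rewrite /F; under eq_Rintegral do rewrite /phase mul0r add0r.
  by rewrite RintegralZl ?Rintegral_gauss_kernel ?mulr1//; exact: integrable_gauss_kernel.
move: E; rewrite F0 expr0n/= mulr0 mul0r expR0 mulr1 => <-.
by rewrite expRN mulfK// gt_eqF ?expR_gt0.
Qed.

End fourier.

Section closed_form.
Variable R : realType.
Local Notation mu := (@lebesgue_measure R).

Lemma expiD (x y : R) : expi (x + y) = expi x * expi y.
Proof.
rewrite /expi cosD sinD; apply/eqP; rewrite eq_complex/=.
by apply/andP; split; apply/eqP; ring.
Qed.

Lemma gauss_window_kernel (sigma t x : R) : 0 < sigma ->
  gauss_window sigma (x - t) = gauss_kernel (sigma ^+ 2) t x.
Proof.
move=> s0; rewrite /gauss_window /gauss_kernel sqrtrM ?pi_ge0//.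
by rewrite sqrtr_sqr gtr0_norm// [sigma * _]mulrC.
Qed.

(** With b = pi^2 sigma^2, the modulus at eta of the transform of a pure tone of
    frequency x. *)
Definition tone_profile (b x eta : R) : R := expR (- (b * (eta - x) ^+ 2)).

(** The phase of each tone of frequency xi is 2 pi xi t + 2 pi (xi - eta) (x - t), so its
    contribution is a constant phase times the Fourier transform of the window at
    2 pi (xi - eta). *)
Lemma two_tone_stftE (sigma a xi0 xi1 t eta : R) : 0 < sigma ->
  two_tone_stft sigma a xi0 xi1 t eta =
  expi (2 * pi * xi0 * t) * (tone_profile (pi ^+ 2 * sigma ^+ 2) xi0 eta)%:C +
  expi (2 * pi * xi1 * t) * (a * tone_profile (pi ^+ 2 * sigma ^+ 2) xi1 eta)%:C.
Proof.
move=> s0; rewrite /two_tone_stft /stft /cintegral.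
have s20 : 0 < sigma ^+ 2 by rewrite exprn_gt0.
pose g := gauss_kernel (sigma ^+ 2) t.
pose w xi := 2 * pi * (xi - eta).
have ph xi x : 2 * pi * xi * x + - (2 * pi * eta * (x - t)) =
    w xi * (x - t) + 2 * pi * xi * t by rewrite /w; ring.
have E x : two_tone a xi0 xi1 x * (gauss_window sigma (x - t))%:C *
    expi (- (2 * pi * eta * (x - t))) =
    (g x)%:C * (expi (w xi0 * (x - t) + 2 * pi * xi0 * t)) +
    (a * g x)%:C * (expi (w xi1 * (x - t) + 2 * pi * xi1 * t)).
  rewrite gauss_window_kernel// -!ph !expiD /two_tone.
  have -> : (a * g x)%:C = a%:C * (g x)%:C by rewrite rmorphM.
  by rewrite -/(g x); ring.
have tone xi c : \int[mu]_x (cos (w xi * (x - t) + c) * g x) =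
    cos c * tone_profile (pi ^+ 2 * sigma ^+ 2) xi eta.
  rewrite fourier_gauss_kernel// /tone_profile; congr (_ * expR _).
  by rewrite /w; move: pi => p; field.
have sE y : sin y = cos (y - pi / 2) :> R.
  by rewrite cosB cos_pihalf sin_pihalf mulr0 add0r mulr1.
have tones xi c : \int[mu]_x (sin (w xi * (x - t) + c) * g x) =
    sin c * tone_profile (pi ^+ 2 * sigma ^+ 2) xi eta.
  under eq_Rintegral do rewrite sE -addrA.
  by rewrite tone -sE.
have ic xi c : mu.-integrable setT
    (EFin \o (fun x => cos (w xi * (x - t) + c) * g x)).
  exact: integrable_cos_gauss_kernel.
have is_ xi c : mu.-integrable setT
    (EFin \o (fun x => sin (w xi * (x - t) + c) * g x)).
  rewrite [X in _.-integrable _ X](_ : _ =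
    EFin \o (fun x => cos (w xi * (x - t) + (c - pi / 2)) * g x)).
    exact: integrable_cos_gauss_kernel.
  by apply/funext => x /=; rewrite addrA -sE.
pose p xi x := w xi * (x - t) + 2 * pi * xi * t.
have -> : \int[mu]_x complex.Re (two_tone a xi0 xi1 x *
    (gauss_window sigma (x - t))%:C * expi (- (2 * pi * eta * (x - t)))) =
    \int[mu]_x (cos (p xi0 x) * g x + a * (cos (p xi1 x) * g x)).
  by apply: eq_Rintegral => x _; rewrite E/= /p; ring.
have -> : \int[mu]_x complex.Im (two_tone a xi0 xi1 x *
    (gauss_window sigma (x - t))%:C * expi (- (2 * pi * eta * (x - t)))) =
    \int[mu]_x (sin (p xi0 x) * g x + a * (sin (p xi1 x) * g x)).
  by apply: eq_Rintegral => x _; rewrite E/= /p; ring.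
rewrite !RintegralD//; try solve [exact: ic | exact: is_ |
  exact/integrable_EFinZ/ic | exact/integrable_EFinZ/is_].
rewrite !RintegralZl//; try solve [exact: ic | exact: is_].
rewrite /p !tone !tones /expi; apply/eqP; rewrite eq_complex/=.
by apply/andP; split; apply/eqP; ring.
Qed.

End closed_form.

(** * Second-order expansions, change of variables, Gaussian smoothing *)

Section second_order.
Variable R : realType.

(** By the mean value theorem the error is (f' c - f' x0) (x - x0) for some c between
    x0 and x, and f' is Lipschitz at x0 because it is derivable there. *)
Lemma second_order_estimate (f f' : R -> R) (x0 : R) :
  (\forall x \near x0, is_derive x (1 : R) f (f' x)) ->
  derivable f' x0 1 ->
  exists C : R, \forall x \near x0,
    `|f x - f x0 - f' x0 * (x - x0)| <= C * (x - x0) ^+ 2.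
Proof.
move=> df df'.
pose l : R := 'D_1 f' x0; exists (`|l| + 1).
have lip : \forall x \near x0, `|f' x - f' x0| <= (`|l| + 1) * `|x - x0|.
  have : h^-1 *: (f' (h + x0) - f' x0) @[h --> 0^'] --> l.
    by have := df'; rewrite /derivable /l /derive; under eq_fun do rewrite scaler1.
  move=> /cvgrPdist_lt /(_ 1 ltr01) [e/= e0 H].
  exists e => //= x/= xe.
  have [->|xx0] := eqVneq x x0; first by rewrite !subrr !normr0 mulr0.
  have := H (x - x0); rewrite /= sub0r normrN distrC => /(_ xe).
  rewrite subr_eq0 => /(_ xx0); rewrite subrK.
  set q := _ *: _ => ql.
  have -> : f' x - f' x0 = q * (x - x0).
    by rewrite /q /GRing.scale/= mulrAC mulVf ?mul1r// subr_eq0.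
  rewrite normrM (distrC x0) ler_wpM2r//.
  have := ler_normD (q - l) l; rewrite subrK (distrC q) => /le_trans; apply.
  by rewrite addrC lerD2l ltW.
have [e/= e0 He] : \forall x \near x0, is_derive x (1 : R) f (f' x) /\
   `|f' x - f' x0| <= (`|l| + 1) * `|x - x0|.
  by near=> x; split; near: x.
exists e => //= x /= xe.
pose h y := f y - f x0 - f' x0 * (y - x0).
have dh y : ball x0 e y -> is_derive y (1 : R) h (f' y - f' x0).
  move=> ye; have [dfy _] := He _ ye.
  by rewrite /h; apply: is_derive_eq; rewrite /GRing.scale/=; ring.
(* The error h vanishes at x0 and its derivative at c is f' c - f' x0. *)
have h0 : h x0 = 0 by rewrite /h !subrr mulr0 subrr.
have bx : ball x0 e x by [].
have key c : `|c - x0| <= `|x - x0| ->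
    `|(f' c - f' x0) * (x - x0)| <= (`|l| + 1) * (x - x0) ^+ 2.
  move=> cx; have ce : ball x0 e c.
    by rewrite /ball/= distrC (le_lt_trans cx)// distrC.
  have [_ fc] := He _ ce.
  rewrite normrM -(real_normK (num_real (x - x0))) expr2 mulrA ler_wpM2r//.
  by rewrite (le_trans fc)// ler_wpM2l// addr_ge0.
have [xlt|xgt|->] := ltgtP x x0; last first.
- by rewrite -/(h x0) h0 normr0 subrr expr0n mulr0.
- have sub y : y \in `[x0, x] -> ball x0 e y.
    rewrite in_itv/= => /andP[y1 y2]; rewrite /ball/= distrC ger0_norm ?subr_ge0//.
    by move: xe; rewrite /ball/= distrC gtr0_norm ?subr_gt0//; lra.
  have [] := @MVT _ h (fun y => f' y - f' x0) _ _ xgt.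
  + by move=> y yx; apply/dh/sub/subset_itv_oo_cc.
  + by apply: derivable_within_continuous => y yx; case: (dh y (sub _ yx)).
  move=> c; rewrite in_itv/= => /andP[c1 c2].
  rewrite h0 subr0 -/(h x) => ->; apply: key.
  by rewrite !ger0_norm ?subr_ge0; lra.
- have sub y : y \in `[x, x0] -> ball x0 e y.
    rewrite in_itv/= => /andP[y1 y2]; rewrite /ball/= ger0_norm ?subr_ge0//.
    by move: xe; rewrite /ball/= gtr0_norm ?subr_gt0//; lra.
  have [] := @MVT _ h (fun y => f' y - f' x0) _ _ xlt.
  + by move=> y yx; apply/dh/sub/subset_itv_oo_cc.
  + by apply: derivable_within_continuous => y yx; case: (dh y (sub _ yx)).
  move=> c; rewrite in_itv/= => /andP[c1 c2].
  rewrite h0 sub0r -/(h x) => /eqP; rewrite eqr_oppLR => /eqP ->.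
  rewrite normrN -normrN -mulrN opprB; apply: key.
  by rewrite !ler0_norm ?subr_le0; lra.
Unshelve. all: end_near. Qed.

End second_order.

Section substitution.
Variable R : realType.
Local Notation mu := (@lebesgue_measure R).

(** Monotone convergence along two exhaustions whose integrals agree at each stage. *)
Lemma integral_exhaustion_eq (A B : (set R)^nat) (I J : set R) (g h : R -> R) :
  nondecreasing_seq A -> nondecreasing_seq B ->
  (forall n, measurable (A n)) -> (forall n, measurable (B n)) ->
  (forall n, measurable_fun (A n) h) -> (forall n, measurable_fun (B n) g) ->
  (forall n x, A n x -> 0 <= h x) -> (forall n x, B n x -> 0 <= g x) ->
  I = \bigcup_n A n -> J = \bigcup_n B n ->
  (forall n, \int[mu]_(x in B n) (g x)%:E = \int[mu]_(x in A n) (h x)%:E)%E ->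
  (\int[mu]_(x in J) (g x)%:E = \int[mu]_(x in I) (h x)%:E)%E.
Proof.
move=> ndA ndB mA mB mh mg h0 g0 -> -> E.
have cA : (\int[mu]_(x in A n) (h x)%:E)%E @[n --> \oo] -->
    (\int[mu]_(x in \bigcup_n A n) (h x)%:E)%E.
  refine (@ge0_nondecreasing_set_cvg_integral _ (measurableTypeR R) R A
    (EFin \o h) mu ndA mA _ _).
    by move=> n; apply/measurable_EFinP; exact: (mh n).
  by move=> n x xn; rewrite lee_fin; exact: (h0 n x xn).
have cB : (\int[mu]_(x in B n) (g x)%:E)%E @[n --> \oo] -->
    (\int[mu]_(x in \bigcup_n B n) (g x)%:E)%E.
  refine (@ge0_nondecreasing_set_cvg_integral _ (measurableTypeR R) R B
    (EFin \o g) mu ndB mB _ _).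
    by move=> n; apply/measurable_EFinP; exact: (mg n).
  by move=> n x xn; rewrite lee_fin; exact: (g0 n x xn).
have EE : (fun n => \int[mu]_(x in B n) (g x)%:E)%E =
    (fun n => \int[mu]_(x in A n) (h x)%:E)%E by apply/funext.
by rewrite EE in cB; exact: (cvg_unique _ cB cA).
Qed.

Variables (F K : R -> R) (c d : nat -> R) (I J : set R).
Hypotheses (c_noninc : forall n m, (n <= m)%N -> c m <= c n).
Hypotheses (d_nondec : forall n m, (n <= m)%N -> d n <= d m).
Hypotheses (cd : forall n, c n < d n).
Hypothesis I_exh : I = \bigcup_n `[c n, d n]%classic.
Hypothesis J_itv : is_interval J.
Hypothesis FI : forall x, I x -> J (F x).
Hypothesis KJ : forall y, J y -> I (K y) /\ F (K y) = y.
Hypothesis dF : forall x, I x -> derivable F x 1.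
Hypothesis cdF : forall x, I x -> {for x, continuous (derive1 F)}.
Hypothesis monoF :
  (forall x, I x -> 0 < derive1 F x) \/ (forall x, I x -> derive1 F x < 0).

Let subI n x : x \in `[c n, d n] -> I x.
Proof. by move=> xn; rewrite I_exh; exists n. Qed.

Let nd_cd : nondecreasing_seq (fun n => `[c n, d n]%classic).
Proof.
move=> n m nm; apply/subsetPset => x /=; rewrite !in_itv/= => /andP[x1 x2].
by rewrite (le_trans (c_noninc nm))// (le_trans x2 (d_nondec nm)).
Qed.

Let Ic n : I (c n). Proof. by apply: (@subI n); rewrite in_itv/= lexx ltW. Qed.

Let Id n : I (d n). Proof. by apply: (@subI n); rewrite in_itv/= lexx ltW. Qed.

Let continuous_F x : I x -> {for x, continuous F}.
Proof. by move=> Ix; apply/differentiable_continuous/derivable1_diffP/dF. Qed.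

Let derivable_oo n : derivable_oo_LRcontinuous F (c n) (d n).
Proof.
split.
- by move=> x xn; apply/dF/(@subI n)/subset_itv_oo_cc.
- by apply/cvg_at_right_filter/continuous_F.
- by apply/cvg_at_left_filter/continuous_F.
Qed.

Let mJ x y z : J x -> J y -> x <= z -> z <= y -> J z.
Proof. by move=> Jx Jy xz zy; apply: (J_itv Jx Jy); rewrite xz zy. Qed.

Let common x y : I x -> I y -> exists n, x \in `[c n, d n] /\ y \in `[c n, d n].
Proof.
rewrite I_exh => -[n _ xn] [m _ ym]; exists (maxn n m).
have /subsetPset sn := nd_cd (leq_maxl n m).
have /subsetPset sm := nd_cd (leq_maxr n m).
by split; [exact: (sn x)|exact: (sm y)].
Qed.

Let continuous_within n : {within `[c n, d n]%classic, continuous F}.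
Proof. by apply: derivable_within_continuous => x /subI; exact: dF. Qed.

Let incr : (forall x, I x -> 0 < derive1 F x) ->
  forall x y, I x -> I y -> x < y -> F x < F y.
Proof.
move=> F'0 x y Ix Iy xy; have [n [xn yn]] := common Ix Iy.
apply: (@gtr0_derive1_lt_cc _ _ (c n) (d n)) => //.
- by move=> z /subset_itv_oo_cc/subI; exact: dF.
- by move=> z /subset_itv_oo_cc/subI; exact: F'0.
Qed.

Let decr : (forall x, I x -> derive1 F x < 0) ->
  forall x y, I x -> I y -> x < y -> F y < F x.
Proof.
move=> F'0 x y Ix Iy xy; have [n [xn yn]] := common Ix Iy.
apply: (@ltr0_derive1_lt_cc _ _ (c n) (d n)) => //.
- by move=> z /subset_itv_oo_cc/subI; exact: dF.
- by move=> z /subset_itv_oo_cc/subI; exact: F'0.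
Qed.

(** The image of [c n, d n] is the segment between the images of its endpoints, and
    these segments exhaust J because F has the right inverse K; so the change of
    variables on compact segments passes to the limit. *)
Lemma ge0_substitution (G : R -> R) : (forall y, J y -> {for y, continuous G}) ->
  (forall y, 0 <= G y) ->
  (\int[mu]_(y in J) (G y)%:E = \int[mu]_(x in I) (G (F x) * `|derive1 F x|)%:E)%E.
Proof.
move=> cG G0.
have mG A : A `<=` J -> measurable A -> measurable_fun A G.
  move=> AJ mA; apply: subspace_continuous_measurable_fun => //.
  apply: continuous_in_subspaceT => y /set_mem Ay; exact/cG/AJ.
have mh n : measurable_fun `[c n, d n]%classic (fun x => G (F x) * `|derive1 F x|).
  apply: subspace_continuous_measurable_fun => //.
  apply: continuous_in_subspaceT => x /set_mem xn.
  have Ix := subI xn.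
  apply: cvgM; last by apply: cvg_norm; exact: cdF.
  by apply: continuous_comp; [exact: continuous_F|exact/cG/FI].
have cvgdF n : cvg (derive1 F x @[x --> (c n)^'+]) /\ cvg (derive1 F x @[x --> (d n)^'-]).
  split; apply/cvg_ex; eexists.
    by apply/cvg_at_right_filter/cdF/Ic.
  by apply/cvg_at_left_filter/cdF/Id.
have cdFn n : {in `](c n), (d n)[, continuous (derive1 F)}.
  by move=> x xn; apply/cdF/(@subI n)/subset_itv_oo_cc.
have mA n : measurable `[c n, d n]%classic by [].
have [F'0|F'0] := monoF.
- have inc := incr F'0.
  have incW x y : I x -> I y -> x <= y -> F x <= F y.
    by move=> Ix Iy; rewrite le_eqVlt => /predU1P[->//|xy]; exact/ltW/inc.
  have BJ n : `[F (c n), F (d n)] `<=` J.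
    by move=> y /=; rewrite in_itv/= => /andP[]; apply: mJ; exact: FI.
  apply: (@integral_exhaustion_eq _ (fun n => `[F (c n), F (d n)]%classic) _ _ G _ nd_cd).
  + move=> n m nm; apply/subsetPset => x /=; rewrite !in_itv/= => /andP[x1 x2].
    rewrite (le_trans (incW _ _ (Ic m) (Ic n) (c_noninc nm)))//=.
    by rewrite (le_trans x2)// incW// d_nondec.
  + by [].
  + by [].
  + exact: mh.
  + by move=> n; apply: mG.
  + by move=> n x _; rewrite mulr_ge0.
  + by move=> n x _; exact: G0.
  + exact: I_exh.
  + apply/seteqP; split => [y Jy|y [n _]]; last exact: BJ.
    have [IK FK] := KJ Jy; move: (IK); rewrite I_exh => -[n _ /= Kn].
    exists n => //=; rewrite in_itv/= -FK.
    by move: Kn; rewrite in_itv/= => /andP[k1 k2]; rewrite !incW.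
  + move=> n; rewrite integration_by_substitution_increasing//.
    * apply: eq_integral => x /set_mem xn /=.
      by rewrite gtr0_norm//; exact/F'0/(subI xn).
    * exact: ltW.
    * by move=> x y /subI Ix /subI Iy; exact: inc.
    * by case: (cvgdF n).
    * by case: (cvgdF n).
    * by apply: continuous_in_subspaceT => y /set_mem yn; exact/cG/(BJ n).
- have dec := decr F'0.
  have decW x y : I x -> I y -> x <= y -> F y <= F x.
    by move=> Ix Iy; rewrite le_eqVlt => /predU1P[->//|xy]; exact/ltW/dec.
  have BJ n : `[F (d n), F (c n)] `<=` J.
    by move=> y /=; rewrite in_itv/= => /andP[]; apply: mJ; exact: FI.
  apply: (@integral_exhaustion_eq _ (fun n => `[F (d n), F (c n)]%classic) _ _ G _ nd_cd).
  + move=> n m nm; apply/subsetPset => x /=; rewrite !in_itv/= => /andP[x1 x2].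
    rewrite (le_trans (decW _ _ (Id n) (Id m) (d_nondec nm)))//=.
    by rewrite (le_trans x2)// decW// c_noninc.
  + by [].
  + by [].
  + exact: mh.
  + by move=> n; apply: mG.
  + by move=> n x _; rewrite mulr_ge0.
  + by move=> n x _; exact: G0.
  + exact: I_exh.
  + apply/seteqP; split => [y Jy|y [n _]]; last exact: BJ.
    have [IK FK] := KJ Jy; move: (IK); rewrite I_exh => -[n _ /= Kn].
    exists n => //=; rewrite in_itv/= -FK.
    by move: Kn; rewrite in_itv/= => /andP[k1 k2]; rewrite !decW.
  + move=> n; rewrite integration_by_substitution_decreasing//.
    * apply: eq_integral => x /set_mem xn /=.
      by rewrite ltr0_norm//; exact/F'0/(subI xn).
    * exact: ltW.
    * by move=> x y /subI Ix /subI Iy; exact: dec.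
    * by case: (cvgdF n).
    * by case: (cvgdF n).
    * by apply: continuous_in_subspaceT => y /set_mem yn; exact/cG/(BJ n).
Qed.

(** A signed integral is by definition the difference of the integrals of the positive
    and negative parts. *)
Lemma integral_substitution (G : R -> R) : (forall y, J y -> {for y, continuous G}) ->
  (\int[mu]_(y in J) (G y)%:E = \int[mu]_(x in I) (G (F x) * `|derive1 F x|)%:E)%E.
Proof.
move=> cG.
have cp : forall y, J y -> {for y, continuous (fun y => Num.max (G y) 0)}.
  by move=> y Jy; apply: continuous_max; [exact: cG|exact: cvg_cst].
have cn : forall y, J y -> {for y, continuous (fun y => Num.max (- G y) 0)}.
  by move=> y Jy; apply: continuous_max; [apply: cvgN; exact: cG|exact: cvg_cst].
rewrite integralE [RHS]integralE; congr (_ - _)%E.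
- transitivity (\int[mu]_(y in J) (Num.max (G y) 0)%:E)%E.
    by apply: eq_integral => y _; rewrite funeposE EFin_max.
  rewrite ge0_substitution//; last by move=> y; rewrite le_max lexx orbT.
  apply: eq_integral => x _; rewrite funeposE -EFin_max.
  by rewrite maxr_pMl ?mul0r.
- transitivity (\int[mu]_(y in J) (Num.max (- G y) 0)%:E)%E.
    by apply: eq_integral => y _; rewrite funenegE EFin_max EFinN.
  rewrite ge0_substitution//; last by move=> y; rewrite le_max lexx orbT.
  apply: eq_integral => x _; rewrite funenegE -EFinN -EFin_max.
  by rewrite maxr_pMl ?mul0r ?mulNr.
Qed.

End substitution.

Section concentration.
Variable R : realType.
Local Notation mu := (@lebesgue_measure R).

Lemma integrable_mul_gauss_kernel (th : R -> R) (C alpha m : R) :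
  measurable_fun setT th -> (forall s, `|th s| <= C) -> 0 < alpha ->
  mu.-integrable setT (EFin \o (fun s => th s * gauss_kernel alpha m s)).
Proof.
move=> mth thC a0.
have C0 : 0 <= C by exact: le_trans (thC 0).
apply: (@le_integrable _ _ _ mu _ _ _ (EFin \o (fun s => C * gauss_kernel alpha m s))) => //.
- by apply/measurable_EFinP/measurable_funM => //; exact: measurable_gauss_kernel.
- move=> s _ /=; rewrite lee_fin [leLHS]normrM [leRHS]normrM (ger0_norm C0).
  by rewrite (ger0_norm (gauss_kernel_ge0 _ _ _)) ler_wpM2r// gauss_kernel_ge0.
- by apply: integrable_EFinZ; exact: integrable_gauss_kernel.
Qed.

Variables (E : set R) (th : R -> R) (C : R).
Hypotheses (mE : measurable E) (mth : measurable_fun E th).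
Hypotheses (C0 : 0 <= C) (thC : forall s, E s -> `|th s| <= C).

Let T : R -> R := th \_ E.

Let mT : measurable_fun setT T.
Proof. exact/(measurable_restrictT _ _).1. Qed.

Let TC s : `|T s| <= C.
Proof. by rewrite /T patchE; case: ifPn => [/set_mem/thC//|_]; rewrite normr0. Qed.

Let int_T alpha m : \int[mu]_(s in E) (th s * gauss_kernel alpha m s) =
  \int[mu]_s (T s * gauss_kernel alpha m s).
Proof.
rewrite Rintegral_mkcond; apply: eq_Rintegral => s _.
by rewrite /T !patchE; case: ifP; rewrite ?mul0r.
Qed.

(** Boundedness upgrades the local second-order expansion to a bound
    |T s - T xi - l (s - xi)| <= K2 (s - xi)^2 valid for all s, where T is th extended
    by 0.  Against the kernel the linear term integrates to 0 and the quadratic one to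
    O(alpha). *)
Lemma gauss_kernel_smoothing xi l C2 : E xi ->
  (\forall s \near xi, E s /\
     `|th s - th xi - l * (s - xi)| <= C2 * (s - xi) ^+ 2) ->
  exists K : R, forall alpha, 0 < alpha ->
    `|\int[mu]_(s in E) (th s * gauss_kernel alpha xi s) - th xi| <= K * alpha.
Proof.
move=> Exi [d /= d0 near_xi].
have Txi : T xi = th xi by rewrite /T patchE mem_set.
(* The first summand serves near xi; where |s - xi| >= d, the last two bound the
   constant and the linear term by multiples of (s - xi)^2. *)
pose K2 : R := `|C2| + 2 * C / d ^+ 2 + `|l| / d.
have K20 : 0 <= K2.
  by rewrite !addr_ge0// divr_ge0// ?mulr_ge0// ?sqr_ge0// ltW.
have quad s : `|T s - T xi - l * (s - xi)| <= K2 * (s - xi) ^+ 2.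
  have [sd|ds] := ltP `|xi - s| d.
    have [Es bs] := near_xi s sd.
    rewrite Txi /T patchE mem_set// (le_trans bs)// ler_wpM2r ?sqr_ge0//.
    rewrite (le_trans (ler_norm _))// /K2 -addrA lerDl addr_ge0//.
      by rewrite divr_ge0 ?sqr_ge0// mulr_ge0.
    by rewrite divr_ge0// ltW.
  rewrite distrC in ds; set x := s - xi in ds *.
  have x0 : 0 < `|x| by exact: lt_le_trans ds.
  rewrite -(real_normK (num_real x)).
  apply: (@le_trans _ _ (2 * C + `|l| * `|x|)).
    rewrite (le_trans (ler_normB _ _))// normrM lerD2r.
    rewrite (le_trans (ler_normB _ _))//.
    by have := TC s; have := TC xi; lra.
  rewrite /K2 2!mulrDl -addrA.
  have h1 : 2 * C <= 2 * C / d ^+ 2 * `|x| ^+ 2.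
    rewrite mulrAC ler_pdivlMr ?exprn_gt0// ler_wpM2l ?mulr_ge0//.
    by rewrite lerXn2r ?nnegrE// ltW.
  have h2 : `|l| * `|x| <= `|l| / d * `|x| ^+ 2.
    rewrite mulrAC ler_pdivlMr// -mulrA ler_wpM2l// expr2.
    by rewrite ler_wpM2l// ltW.
  have h3 : 0 <= `|C2| * `|x| ^+ 2 by rewrite mulr_ge0 ?sqr_ge0.
  by lra.
exists (K2 * 4) => alpha a0.
have i1 := integrable_mul_gauss_kernel xi mT TC a0.
have i2 := integrable_gauss_kernel xi a0.
have i3 := integrable_id_gauss_kernel xi a0.
have i4 := integrable_sqr_gauss_kernel xi a0.
pose r s := (T s * gauss_kernel alpha xi s - T xi * gauss_kernel alpha xi s)
   - l * ((s - xi) * gauss_kernel alpha xi s).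
have rE : \int[mu]_s r s = \int[mu]_(s in E) (th s * gauss_kernel alpha xi s) - th xi.
  rewrite /r RintegralB//; [|exact/integrable_EFinB/integrable_EFinZ|exact: integrable_EFinZ].
  rewrite RintegralB//; last exact: integrable_EFinZ.
  have -> : \int[mu]_s (T xi * gauss_kernel alpha xi s) = T xi.
    by rewrite RintegralZl// Rintegral_gauss_kernel// mulr1.
  have -> : \int[mu]_s (l * ((s - xi) * gauss_kernel alpha xi s)) = 0.
    by rewrite RintegralZl// Rintegral_id_gauss_kernel// mulr0.
  by rewrite subr0 int_T Txi.
have ir : mu.-integrable setT (EFin \o r) :=
  integrable_EFinB (integrable_EFinB i1 (integrable_EFinZ _ i2)) (integrable_EFinZ _ i3).
rewrite -rE (le_trans (le_normr_Rintegral _ ir))//.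
apply: (@le_trans _ _ (\int[mu]_s (K2 * ((s - xi) ^+ 2 * gauss_kernel alpha xi s)))).
  apply: le_Rintegral => //; [exact: integrable_norm|exact: integrable_EFinZ|].
  move=> s _; rewrite /r.
  have -> : T s * gauss_kernel alpha xi s - T xi * gauss_kernel alpha xi s -
      l * ((s - xi) * gauss_kernel alpha xi s) =
      (T s - T xi - l * (s - xi)) * gauss_kernel alpha xi s by ring.
  rewrite normrM (ger0_norm (gauss_kernel_ge0 _ _ _)) mulrA ler_wpM2r//.
  exact: gauss_kernel_ge0.
rewrite RintegralZl// -mulrA ler_wpM2l//.
exact: Rintegral_sqr_gauss_kernel_le.
Qed.

(** The hypothesis compares the kernel at xi with the one at p pointwise on E, with the
    factor exp (- q / alpha); the kernel at p has integral 1, so no power of alpha is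
    lost. *)
Lemma gauss_kernel_tail xi p q : (forall s, E s -> q + (s - p) ^+ 2 <= (s - xi) ^+ 2) ->
  forall alpha, 0 < alpha ->
    `|\int[mu]_(s in E) (th s * gauss_kernel alpha xi s)| <= C * expR (- (q / alpha)).
Proof.
move=> far alpha a0; rewrite int_T.
have i1 := integrable_mul_gauss_kernel xi mT TC a0.
have i2 := integrable_gauss_kernel p a0.
rewrite (le_trans (le_normr_Rintegral _ i1))//.
apply: (@le_trans _ _ (\int[mu]_s (C * expR (- (q / alpha)) * gauss_kernel alpha p s))); last first.
  by rewrite RintegralZl// Rintegral_gauss_kernel// mulr1.
apply: le_Rintegral => //; [exact: integrable_norm|exact: integrable_EFinZ|] => s _.
rewrite normrM (ger0_norm (gauss_kernel_ge0 _ _ _)) /T patchE.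
case: ifPn => [/set_mem Es|_]; last first.
  by rewrite normr0 mul0r !mulr_ge0 ?expR_ge0 ?gauss_kernel_ge0.
rewrite -mulrA ler_pM ?gauss_kernel_ge0 ?thC//.
rewrite /gauss_kernel mulrCA ler_wpM2l ?invr_ge0// -expRD ler_expR.
by rewrite -opprD lerN2 -mulrDl ler_wpM2r ?invr_ge0 ?far// ltW.
Qed.

End concentration.

(** * The instantaneous frequency and its inverse *)

Lemma sqrt_expR (R : realType) (x : R) : Num.sqrt (expR x) = expR (x / 2).
Proof.
have -> : x = x / 2 + x / 2 by rewrite -splitr.
rewrite expRD -expr2 sqrtr_sqr ger0_norm ?expR_ge0//.
by congr expR; field.
Qed.

Section real_model.
Variables (R : realType) (b a xi0 xi1 eps : R).
Hypotheses (b_gt0 : 0 < b) (a_gt0 : 0 < a) (lt_xi01 : xi0 < xi1).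
Hypothesis eps2 : eps ^+ 2 = 1.

Local Notation D := (xi1 - xi0).
Local Notation u := (u_star xi0 xi1).

(** The ratio of the moduli of the second and the first tone at eta. *)
Definition tone_ratio (eta : R) : R :=
  a * expR (2 * b * D * (eta - (xi0 + xi1) / 2)).

Definition weight (eta : R) : R := 1 + eps * tone_ratio eta.

Definition inst_freq (eta : R) : R :=
  (xi0 + eps * tone_ratio eta * xi1) / weight eta.

(** The derivative of [inst_freq], written as the right-hand side of the logistic
    equation it satisfies. *)
Definition freq_rate (eta : R) : R :=
  - (2 * b * (inst_freq eta - xi0) * (inst_freq eta - xi1)).

(** The solution of [inst_freq eta = s], obtained from [tone_ratio eta = - eps u]. *)
Definition freq_inv (s : R) : R :=
  (xi0 + xi1) / 2 + ln (- (eps * u s) / a) / (2 * b * D).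

(** The transform, freed of its carrier, divided by the modulus of [freq_rate], both
    at [freq_inv s]. *)
Definition density (s : R) : R :=
  tone_profile b xi0 (freq_inv s) * (1 - u s)
  / (2 * b * `|(s - xi0) * (s - xi1)|).

Lemma D_gt0 : 0 < D. Proof. by rewrite subr_gt0. Qed.

Let b_neq0 : b != 0. Proof. by rewrite gt_eqF. Qed.

Let D_neq0 : D != 0. Proof. by rewrite gt_eqF ?D_gt0. Qed.

Let a_neq0 : a != 0. Proof. by rewrite gt_eqF. Qed.

Lemma tone_ratio_gt0 eta : 0 < tone_ratio eta.
Proof. by rewrite mulr_gt0 ?expR_gt0. Qed.

Lemma tone_ratioE eta :
  a * tone_profile b xi1 eta = tone_ratio eta * tone_profile b xi0 eta.
Proof.
by rewrite /tone_ratio /tone_profile -(mulrA a) -expRD; congr (_ * expR _); field.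
Qed.

Lemma inst_freqB0 eta : weight eta != 0 ->
  inst_freq eta - xi0 = eps * tone_ratio eta * D / weight eta.
Proof. by move=> w0; rewrite /inst_freq; move: w0; rewrite /weight => w0; field. Qed.

Lemma inst_freqB1 eta : weight eta != 0 ->
  inst_freq eta - xi1 = - (D / weight eta).
Proof. by move=> w0; rewrite /inst_freq; move: w0; rewrite /weight => w0; field. Qed.

Lemma u_inst_freq eta : weight eta != 0 ->
  u (inst_freq eta) = - (eps * tone_ratio eta).
Proof.
move=> w0; rewrite /u_star inst_freqB0// inst_freqB1//.
by field; rewrite w0 D_neq0.
Qed.

(** Since eps^2 = 1, - eps u(inst_freq eta) is the tone ratio itself, and the logarithm
    inverts its exponential. *)
Lemma freq_inv_inst_freq eta : weight eta != 0 -> freq_inv (inst_freq eta) = eta.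
Proof.
move=> w0; rewrite /freq_inv u_inst_freq// mulrN opprK.
have -> : eps * (eps * tone_ratio eta) = tone_ratio eta.
  by rewrite mulrA -expr2 eps2 mul1r.
rewrite /tone_ratio mulrAC divff ?gt_eqF// mul1r expRK.
by field; rewrite D_neq0 b_neq0.
Qed.

Section at_regular_point.
Variable s : R.
Hypothesis s_reg : 0 < - (eps * u s).

Lemma reg_neq1 : s - xi1 != 0.
Proof. by apply: contraTneq s_reg => s1; rewrite /u_star s1 invr0 !mulr0 oppr0 ltxx. Qed.

Lemma reg_neq0 : s - xi0 != 0.
Proof. by apply: contraTneq s_reg => s1; rewrite /u_star s1 mul0r mulr0 oppr0 ltxx. Qed.

Lemma tone_ratio_freq_inv : tone_ratio (freq_inv s) = - (eps * u s).
Proof.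
rewrite /tone_ratio /freq_inv.
have -> : 2 * b * D * ((xi0 + xi1) / 2 + ln (- (eps * u s) / a) / (2 * b * D)
   - (xi0 + xi1) / 2) = ln (- (eps * u s) / a).
  by field; rewrite D_neq0 b_neq0.
by rewrite lnK ?posrE ?divr_gt0// mulrC divfK// gt_eqF.
Qed.

Lemma weight_freq_inv : weight (freq_inv s) = 1 - u s.
Proof. by rewrite /weight tone_ratio_freq_inv mulrN mulrA -expr2 eps2 mul1r. Qed.

Lemma one_minus_u : 1 - u s = - (D / (s - xi1)).
Proof. by rewrite /u_star; field; exact: reg_neq1. Qed.

Lemma weight_freq_inv_neq0 : weight (freq_inv s) != 0.
Proof.
rewrite weight_freq_inv one_minus_u oppr_eq0 mulf_neq0// ?invr_eq0 ?reg_neq1//.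

Qed.

Lemma inst_freq_freq_inv : inst_freq (freq_inv s) = s.
Proof.
apply/eqP; rewrite -subr_eq0 -(subrKA xi1) inst_freqB1 ?weight_freq_inv_neq0//.
rewrite weight_freq_inv one_minus_u; apply/eqP.
by field; rewrite reg_neq1 gt_eqF ?D_gt0.
Qed.

End at_regular_point.

Lemma inst_freq_reg eta : weight eta != 0 -> 0 < - (eps * u (inst_freq eta)).
Proof.
by move=> w0; rewrite u_inst_freq// mulrN opprK mulrA -expr2 eps2 mul1r tone_ratio_gt0.
Qed.

Lemma freq_rate_neq0 eta : weight eta != 0 -> freq_rate eta != 0.
Proof.
move=> w0; have r := inst_freq_reg w0; rewrite /freq_rate oppr_eq0 !mulf_neq0//.
- exact: reg_neq0 r.
- exact: reg_neq1 r.
Qed.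

(** The integrand of the transform as a density times a Jacobian. *)
Lemma density_inst_freq eta : weight eta != 0 ->
  density (inst_freq eta) * `|freq_rate eta| =
  tone_profile b xi0 eta * weight eta.
Proof.
move=> w0; have r := freq_rate_neq0 w0.
have E : `|freq_rate eta| =
    2 * b * `|(inst_freq eta - xi0) * (inst_freq eta - xi1)|.
  by rewrite /freq_rate normrN -mulrA [LHS]normrM (@gtr0_norm _ (2 * b)) ?(mulr_gt0 _ b_gt0).
rewrite /density freq_inv_inst_freq// -E u_inst_freq// opprK divfK//.
by rewrite normr_eq0.
Qed.

Lemma is_derive_tone_ratio eta :
  is_derive eta (1 : R) tone_ratio (2 * b * D * tone_ratio eta).
Proof. by rewrite /tone_ratio; apply: is_derive_eq; rewrite /GRing.scale/=; ring. Qed.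

Lemma is_derive_inst_freq eta : weight eta != 0 ->
  is_derive eta (1 : R) inst_freq (freq_rate eta).
Proof.
move=> w0; have dr := is_derive_tone_ratio eta.
rewrite /freq_rate inst_freqB0// inst_freqB1//.
move: w0; rewrite /inst_freq /weight => w0.
have dw := is_deriveV w0.
by apply: is_derive_eq; rewrite /GRing.scale/=; field.
Qed.

(** Completing the square: the exponent on the right exceeds the one on the left by
    b (eta - x - l / (2 b))^2. *)
Lemma gauss_exp_le (l x y eta : R) :
  expR (- (b * (eta - x) ^+ 2)) * expR (l * (eta - y)) <=
  expR (l ^+ 2 / (4 * b) + l * (x - y)).
Proof.
rewrite -expRD ler_expR -subr_ge0.
have -> : l ^+ 2 / (4 * b) + l * (x - y) -
    (- (b * (eta - x) ^+ 2) + l * (eta - y)) = b * (eta - x - l / (2 * b)) ^+ 2.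
  by field.
by rewrite mulr_ge0 ?sqr_ge0 ?ltW.
Qed.

(** In terms of eta = freq_inv s and rho = tone_ratio eta the density is
    G |1 + eps rho|^3 / (2 b D^2 rho), at most a constant times G / rho + G rho^2.
    Both terms are Gaussians in eta, bounded by [gauss_exp_le]; this covers the
    endpoints xi0, xi1 and infinity uniformly. *)
Lemma density_bounded : exists2 C : R, 0 <= C &
  forall s, 0 < - (eps * u s) -> `|density s| <= C.
Proof.
pose E l := expR (l ^+ 2 / (4 * b) + l * (xi0 - (xi0 + xi1) / 2)).
pose C := 4 * (a^-1 * E (- (2 * b * D)) + a ^+ 2 * E (2 * (2 * b * D))) / (2 * b * D ^+ 2).
exists C.
  rewrite divr_ge0 ?(mulr_ge0 _ (sqr_ge0 _)) ?mulr_ge0 ?(ltW b_gt0)//.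
  by rewrite addr_ge0// mulr_ge0 ?expR_ge0 ?invr_ge0 ?sqr_ge0 ?(ltW a_gt0).
move=> s sr.
have w0 := weight_freq_inv_neq0 sr.
have fs := inst_freq_freq_inv sr.
move: w0 fs; set eta := freq_inv s => w0 fs.
have := density_inst_freq w0; rewrite fs => dE.
have r0 := freq_rate_neq0 w0.
have -> : density s = tone_profile b xi0 eta * weight eta / `|freq_rate eta|.
  by rewrite -dE mulfK ?normr_eq0.
set rho := tone_ratio eta.
have rho0 : 0 < rho by exact: tone_ratio_gt0.
have eps1 : `|eps| = 1 by apply/eqP; rewrite -sqrp_eq1// real_normK ?num_real// eps2.
have frE : `|freq_rate eta| = 2 * b * D ^+ 2 * rho / `|weight eta| ^+ 2.
  rewrite /freq_rate inst_freqB0// inst_freqB1// -/rho; clearbody rho.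
  rewrite normrN !normrM !normrN !normrM.
  rewrite eps1 !normfV (gtr0_norm rho0) (gtr0_norm b_gt0) (gtr0_norm D_gt0).
  rewrite (@ger0_norm _ 2)//; field.
  by rewrite normr_eq0.
have wle : `|weight eta| <= 1 + rho.
  by rewrite (le_trans (ler_normD _ _))// normr1 normrM eps1 mul1r gtr0_norm.
set G := tone_profile b xi0 eta.
have G0 : 0 < G by exact: expR_gt0.
rewrite normrM normfV normr_id normrM (gtr0_norm G0) frE.
have K0 : 0 < 2 * b * D ^+ 2 by rewrite !mulr_gt0 ?exprn_gt0 ?D_gt0.
have -> : G * `|weight eta| / (2 * b * D ^+ 2 * rho / `|weight eta| ^+ 2) =
    G * `|weight eta| ^+ 3 / rho / (2 * b * D ^+ 2).
  by field; rewrite normr_eq0 w0 b_neq0 D_neq0 gt_eqF.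
rewrite ler_pM2r ?invr_gt0//.
have w3 : `|weight eta| ^+ 3 <= 4 * (1 + rho ^+ 3).
  apply: (@le_trans _ _ ((1 + rho) ^+ 3)); first by rewrite lerXn2r// nnegrE addr_ge0// ltW.
  rewrite -subr_ge0.
  have -> : 4 * (1 + rho ^+ 3) - (1 + rho) ^+ 3 = 3 * ((1 + rho) * (1 - rho) ^+ 2) by ring.
  by rewrite mulr_ge0// mulr_ge0 ?sqr_ge0// addr_ge0// ltW.
apply: (@le_trans _ _ (G * (4 * (1 + rho ^+ 3)) / rho)).
  by rewrite ler_pM2r ?invr_gt0// ler_wpM2l// ltW.
have -> : G * (4 * (1 + rho ^+ 3)) / rho = 4 * (G / rho + G * rho ^+ 2).
  by field; rewrite gt_eqF.
rewrite ler_wpM2l// lerD//.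
  rewrite /rho /tone_ratio invfM -expRN mulrCA ler_wpM2l ?invr_ge0 ?(ltW a_gt0)//.
  by rewrite -mulNr; exact: gauss_exp_le.
rewrite /rho /tone_ratio exprMn mulrCA ler_wpM2l ?sqr_ge0// expr2 -expRD.
have -> : 2 * b * D * (eta - (xi0 + xi1) / 2) + 2 * b * D * (eta - (xi0 + xi1) / 2) =
  2 * (2 * b * D) * (eta - (xi0 + xi1) / 2) by ring.
exact: gauss_exp_le.
Qed.

Lemma near_regular s0 : 0 < - (eps * u s0) -> \forall s \near s0, 0 < - (eps * u s).
Proof.
move=> r; have n1 := reg_neq1 r.
have : - (eps * u s) @[s --> s0] --> - (eps * u s0).
  apply: cvgN; apply: cvgMl_tmp; apply: cvgM.
    by apply: cvgB => //; exact: cvg_cst.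
  by apply: cvgV => //; apply: cvgB => //; exact: cvg_cst.
by move/cvgrPdist_lt => /(_ _ r); apply: filterS => s; rewrite ltr_norml; lra.
Qed.

Lemma is_derive_freq_inv s : 0 < - (eps * u s) ->
  is_derive s (1 : R) freq_inv (- ((2 * b)^-1 * ((s - xi0)^-1 * (s - xi1)^-1))).
Proof.
move=> r; have n1 := reg_neq1 r; have n0 := reg_neq0 r.
have du : is_derive s (1 : R) (fun s => - (eps * u s) / a)
    (- (eps * (- D / (s - xi1) ^+ 2)) / a).
  rewrite /u_star.
  have dv : is_derive s (1 : R) (fun s => (s - xi1)^-1) (- (s - xi1) ^- 2 *: (1 - 0)).
    exact: is_deriveV.
  by apply: is_derive_eq; rewrite /GRing.scale/=; field; rewrite n1 a_neq0.
have dl : is_derive s (1 : R) (fun s => ln (- (eps * u s) / a))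
    ((- (eps * u s) / a)^-1 * (- (eps * (- D / (s - xi1) ^+ 2)) / a)).
  apply: (@is_derive1_comp _ (@ln R) (fun s => - (eps * u s) / a)).
  by apply: is_derive1_ln; rewrite divr_gt0.
rewrite /freq_inv; apply: is_derive_eq; rewrite /GRing.scale/=.
have e0 : eps != 0 by apply: contra_eq_neq eps2 => ->; rewrite expr0n eq_sym oner_eq0.
by rewrite /u_star; field; rewrite n1 n0 a_neq0 b_neq0 e0 D_neq0.
Qed.

(** Near a regular point [density] has this form: |(s - xi0) (s - xi1)| is, up to a
    constant sign, the product itself, and 1 - u = - D / (s - xi1). *)
Let smooth_density (k s : R) : R :=
  k * tone_profile b xi0 (freq_inv s) * ((s - xi0)^-1 * ((s - xi1)^-1 * (s - xi1)^-1)).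

Let smooth_density' (k s : R) : R := smooth_density k s *
  ((freq_inv s - xi0) * ((s - xi0)^-1 * (s - xi1)^-1) - (s - xi0)^-1 - 2 * (s - xi1)^-1).

Let is_derive_smooth_density k s : 0 < - (eps * u s) ->
  is_derive s (1 : R) (smooth_density k) (smooth_density' k s).
Proof.
move=> r; have n1 := reg_neq1 r; have n0 := reg_neq0 r.
have dv1 : is_derive s (1 : R) (fun s => (s - xi1)^-1) (- (s - xi1) ^- 2 *: (1 - 0)).
  exact: is_deriveV.
have dv0 : is_derive s (1 : R) (fun s => (s - xi0)^-1) (- (s - xi0) ^- 2 *: (1 - 0)).
  exact: is_deriveV.
have dq := is_derive_freq_inv r.
rewrite /smooth_density' /smooth_density /tone_profile.
apply: is_derive_eq; rewrite /GRing.scale/=.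
by field; rewrite n1 n0 b_neq0.
Qed.

Let derivable_smooth_density' k s : 0 < - (eps * u s) ->
  derivable (smooth_density' k) s 1.
Proof.
move=> r; have n1 := reg_neq1 r; have n0 := reg_neq0 r.
have dv1 : is_derive s (1 : R) (fun s => (s - xi1)^-1) (- (s - xi1) ^- 2 *: (1 - 0)).
  exact: is_deriveV.
have dv0 : is_derive s (1 : R) (fun s => (s - xi0)^-1) (- (s - xi0) ^- 2 *: (1 - 0)).
  exact: is_deriveV.
have dq := is_derive_freq_inv r.
have dd := is_derive_smooth_density k r.
by rewrite /smooth_density'; exact: ex_derive.
Qed.

Let density_smooth s0 : 0 < - (eps * u s0) -> exists k,
  \forall s \near s0, density s = smooth_density k s.
Proof.
move=> r; have n1 := reg_neq1 r; have n0 := reg_neq0 r.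
pose q (s : R) := (s - xi0) * (s - xi1).
have cq : q s @[s --> s0] --> q s0.
  by apply: cvgM; apply: cvgB => //; exact: cvg_cst.
have E t s : t ^+ 2 = 1 -> `|q s| = t * q s -> 0 < - (eps * u s) ->
    density s = smooth_density (- (t^-1 * D / (2 * b))) s.
  move=> t2 qs rs; rewrite /density -/(q s) qs one_minus_u// /smooth_density /q.
  have t0 : t != 0 by apply: contra_eq_neq t2 => ->; rewrite expr0n eq_sym oner_eq0.
  by field; rewrite t0 b_neq0 (reg_neq0 rs) (reg_neq1 rs).
have [qn|qp|q0] := ltgtP (q s0) 0; last first.
- by have := mulf_neq0 n0 n1; rewrite -/(q s0) q0 eqxx.
- exists (- (1^-1 * D / (2 * b))); near=> s; apply: E; rewrite ?expr1n//.
    rewrite mul1r gtr0_norm//; near: s.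
    by move/cvgrPdist_lt : cq => /(_ _ qp); apply: filterS => s; rewrite ltr_norml; lra.
  by near: s; exact: near_regular.
- exists (- ((- 1)^-1 * D / (2 * b))); near=> s; apply: E; rewrite ?sqrrN ?expr1n//.
    rewrite mulN1r ltr0_norm//; near: s.
    have qn' : 0 < - q s0 by rewrite oppr_gt0.
    by move/cvgrPdist_lt : cq => /(_ _ qn'); apply: filterS => s; rewrite ltr_norml; lra.
  by near: s; exact: near_regular.
Unshelve. all: end_near. Qed.

Lemma density_second_order s0 : 0 < - (eps * u s0) -> exists l C : R,
  \forall s \near s0, `|density s - density s0 - l * (s - s0)| <= C * (s - s0) ^+ 2.
Proof.
move=> r; have [k dk] := density_smooth r.
have [C HC] : exists C : R, \forall s \near s0, `|smooth_density k s - smooth_density k s0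
    - smooth_density' k s0 * (s - s0)| <= C * (s - s0) ^+ 2.
  apply: second_order_estimate; last exact: derivable_smooth_density'.
  by near=> s; apply: is_derive_smooth_density; near: s; exact: near_regular.
exists (smooth_density' k s0), C.
rewrite (nbhs_singleton dk).
by near=> s; rewrite (near dk s)//; near: s.
Unshelve. all: end_near. Qed.

Lemma continuous_density s0 : 0 < - (eps * u s0) -> {for s0, continuous density}.
Proof.
move=> r; have [k dk] := density_smooth r.
rewrite /prop_for /continuous_at (nbhs_singleton dk).
apply: (@cvg_trans _ (smooth_density k @ s0)).
  by apply: near_eq_cvg; apply: filterS dk => s ->.
apply/differentiable_continuous/derivable1_diffP.
by case: (is_derive_smooth_density k r).
Qed.

(** With L = ln (- eps u / a) one has freq_inv s - xi0 = D / 2 + L / (2 b D); the cross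
    term of its square gives the factor exp (- L / 2), a square root. *)
Lemma tone_profile_freq_inv s : 0 < - (eps * u s) ->
  tone_profile b xi0 (freq_inv s) =
  expR (- (b * D ^+ 2 / 4)) * Num.sqrt (a / (- (eps * u s))) *
  expR (- (ln (- (eps * u s) / a) ^+ 2 / (4 * b * D ^+ 2))).
Proof.
move=> v0; have va0 : 0 < - (eps * u s) / a by rewrite divr_gt0.
have -> : a / (- (eps * u s)) = expR (- ln (- (eps * u s) / a)).
  by rewrite expRN lnK ?posrE// invf_div.
rewrite sqrt_expR -!expRD /tone_profile /freq_inv; congr expR.
by move: (ln _) => L; field; rewrite D_neq0 b_neq0.
Qed.

End real_model.

(** * Reassigned mass over an interval of frequencies *)

Section reassigned_mass.
Variables (R : realType) (b a xi0 xi1 eps : R).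
Hypotheses (b_gt0 : 0 < b) (a_gt0 : 0 < a) (lt_xi01 : xi0 < xi1).
Hypothesis eps2 : eps ^+ 2 = 1.

Local Notation mu := (@lebesgue_measure R).
Local Notation weight := (weight b a xi0 xi1 eps).
Local Notation inst_freq := (inst_freq b a xi0 xi1 eps).
Local Notation freq_rate := (freq_rate b a xi0 xi1 eps).
Local Notation freq_inv := (freq_inv b a xi0 xi1 eps).
Local Notation density := (density b a xi0 xi1 eps).
Local Notation tone_ratio := (tone_ratio b a xi0 xi1).
Local Notation regular s := (0 < - (eps * u_star xi0 xi1 s)).

(** The integrand of the synchrosqueezing transform at an aligned time, freed of its
    carrier. *)
Definition sst_profile (alpha xi eta : R) : R :=
  tone_profile b xi0 eta * weight eta * gauss_kernel alpha xi (inst_freq eta).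

Let continuous_tone_ratio : continuous tone_ratio.
Proof.
move=> x; apply/differentiable_continuous/derivable1_diffP.
by case: (is_derive_tone_ratio b a xi0 xi1 x).
Qed.

Let continuous_weight : continuous weight.
Proof.
move=> x; apply: cvgD; first exact: cvg_cst.
by apply: cvgMl_tmp; exact: continuous_tone_ratio.
Qed.

Let continuous_tone_profile x0 : continuous (@tone_profile R b x0).
Proof.
move=> x; apply: continuous_comp; last exact: continuous_expR.
apply: cvgN; apply: cvgMl_tmp.
apply: (@continuous_comp _ _ _ (fun x => x - x0) (fun x => x ^+ 2)); last exact: exprn_continuous.
by apply: cvgB => //; exact: cvg_cst.
Qed.

Let continuous_inst_freq x : weight x != 0 -> {for x, continuous inst_freq}.
Proof.
move=> w0; apply/differentiable_continuous/derivable1_diffP.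
by case: (is_derive_inst_freq w0).
Qed.

(** At a zero of the weight [inst_freq] blows up, but the integrand is bounded by a
    multiple of the weight and tends to 0.  Continuity yields measurability. *)
Lemma continuous_sst_profile alpha xi : 0 < alpha -> continuous (sst_profile alpha xi).
Proof.
move=> a0 x; rewrite /continuous_at /sst_profile.
have cGw : tone_profile b xi0 y * weight y @[y --> x] --> tone_profile b xi0 x * weight x.
  by apply: cvgM; [exact: continuous_tone_profile|exact: continuous_weight].
have [w0|w0] := eqVneq (weight x) 0; last first.
  apply: cvgM => //; apply: continuous_comp; first exact: continuous_inst_freq.
  exact: continuous_gauss_kernel.
rewrite w0 mulr0 in cGw *; rewrite mul0r.
pose P := (Num.sqrt (pi * alpha))^-1.
apply: norm_cvg0.
apply: (@squeeze_cvgr _ _ _ _ (cst 0) (fun y => P * `|tone_profile b xi0 y * weight y|)).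
- near=> y; rewrite normr_ge0 normrM mulrC ler_wpM2r//.
  by rewrite ger0_norm ?gauss_kernel_ge0// gauss_kernel_le.
- exact: cvg_cst.
- have : P * `|tone_profile b xi0 y * weight y| @[y --> x] --> P * `|0 : R|.
    by apply: cvgMl_tmp; exact: cvg_norm.
  by rewrite normr0 mulr0.
Unshelve. all: end_near. Qed.

Let integrable_tone_profile x0 : mu.-integrable setT (EFin \o @tone_profile R b x0).
Proof.
have bi : 0 < b^-1 by rewrite invr_gt0.
rewrite [X in _.-integrable _ X](_ : _ = fun x => (Num.sqrt (pi * b^-1))%:E *
    (EFin \o gauss_kernel b^-1 x0) x)%E.
  by apply: integrableZl => //; exact: integrable_gauss_kernel.
apply/funext => x /=; rewrite -EFinM /gauss_kernel invrK mulrA divff ?mul1r.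
  by rewrite /tone_profile (mulrC b).
by rewrite gt_eqF// sqrtr_gt0 mulr_gt0 ?pi_gt0.
Qed.

Lemma integrable_sst_profile alpha xi : 0 < alpha ->
  mu.-integrable setT (EFin \o sst_profile alpha xi).
Proof.
move=> a0; pose P := (Num.sqrt (pi * alpha))^-1.
have P0 : 0 <= P by rewrite invr_ge0.
pose g0 := EFin \o @tone_profile R b xi0.
pose g1 := EFin \o @tone_profile R b xi1.
have ig : mu.-integrable setT (fun x => P%:E * (g0 x + a%:E * g1 x))%E.
  apply: integrableZl => //; apply: integrableD => //; first exact: integrable_tone_profile.
  by apply: integrableZl => //; exact: integrable_tone_profile.
apply: le_integrable ig => //.
  apply/measurable_EFinP; apply: continuous_measurable_fun.
  exact: continuous_sst_profile.
move=> x _ /=; rewrite lee_fin.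
have eps1 : `|eps| = 1 by apply/eqP; rewrite -sqrp_eq1// real_normK ?num_real// eps2.
rewrite (@tone_ratioE R b a xi0 xi1).
have G0 : 0 <= tone_profile b xi0 x by exact: expR_ge0.
have r0 : 0 < tone_ratio x by exact: tone_ratio_gt0.
have -> : tone_profile b xi0 x + tone_ratio x * tone_profile b xi0 x =
  tone_profile b xi0 x * (1 + tone_ratio x) by ring.
rewrite [leRHS]ger0_norm; last by rewrite !mulr_ge0// addr_ge0// ltW.
rewrite /sst_profile normrM mulrC ler_pM//.
  by rewrite ger0_norm ?gauss_kernel_ge0// gauss_kernel_le.
rewrite normrM (ger0_norm G0) ler_wpM2l// /weight.
by rewrite (le_trans (ler_normD _ _))// normr1 normrM eps1 mul1r gtr0_norm.
Qed.

Lemma near_weight_neq0 x : weight x != 0 -> \forall y \near x, weight y != 0.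
Proof.
rewrite -normr_gt0 => w0.
have /cvgrPdist_lt /(_ _ w0) := @continuous_weight x.
by apply: filterS => y; apply: contraTneq => ->; rewrite subr0 ltxx.
Qed.

Lemma derive1_inst_freq x : weight x != 0 -> derive1 inst_freq x = freq_rate x.
Proof. by move=> w0; rewrite derive1E; case: (is_derive_inst_freq w0). Qed.

Lemma continuous_derive1_inst_freq x : weight x != 0 ->
  {for x, continuous (derive1 inst_freq)}.
Proof.
move=> w0; rewrite /prop_for /continuous_at derive1_inst_freq//.
have cr : freq_rate y @[y --> x] --> freq_rate x.
  apply: cvgN; apply: cvgM; last by apply: cvgB; [exact: continuous_inst_freq|exact: cvg_cst].
  by apply: cvgMl_tmp; apply: cvgB; [exact: continuous_inst_freq|exact: cvg_cst].
apply: cvg_trans cr; apply: near_eq_cvg.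
by apply: filterS (near_weight_neq0 w0) => y wy; rewrite derive1_inst_freq.
Qed.

Section piece.
Variables (c d : nat -> R) (I J : set R).
Hypotheses (c_noninc : forall n m, (n <= m)%N -> c m <= c n).
Hypotheses (d_nondec : forall n m, (n <= m)%N -> d n <= d m).
Hypotheses (cd : forall n, c n < d n).
Hypothesis I_exh : I = \bigcup_n `[c n, d n]%classic.
Hypotheses (J_itv : is_interval J) (J_open : open J).
Hypothesis I_regular : forall eta, I eta -> weight eta != 0 /\ J (inst_freq eta).
Hypothesis J_regular : forall s, J s -> regular s /\ I (freq_inv s).
Hypothesis J_sign : (forall s, J s -> (s - xi0) * (s - xi1) < 0) \/
  (forall s, J s -> 0 < (s - xi0) * (s - xi1)).

Let mJ : measurable J. Proof. exact: open_measurable. Qed.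

Let continuous_density_J s : J s -> {for s, continuous density}.
Proof. by move=> /J_regular[r _]; exact: continuous_density. Qed.

Let mdensity : measurable_fun J density.
Proof.
apply: open_continuous_measurable_fun => // s /set_mem Js.
exact: continuous_density_J.
Qed.

(** The change of variables s = inst_freq eta on a branch. *)
Lemma sst_piece alpha xi : 0 < alpha ->
  \int[mu]_(eta in I) sst_profile alpha xi eta =
  \int[mu]_(s in J) (density s * gauss_kernel alpha xi s).
Proof.
move=> a0.
pose G s := density s * gauss_kernel alpha xi s.
have FI eta : I eta -> J (inst_freq eta) by case/I_regular.
have KJ s : J s -> I (freq_inv s) /\ inst_freq (freq_inv s) = s.
  by move=> /J_regular[r Is]; split => //; rewrite inst_freq_freq_inv.
have dF eta : I eta -> derivable inst_freq eta 1.
  by move=> /I_regular[w0 _]; case: (is_derive_inst_freq w0).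
have cdF eta : I eta -> {for eta, continuous (derive1 inst_freq)}.
  by move=> /I_regular[w0 _]; exact: continuous_derive1_inst_freq.
have monoF : (forall eta, I eta -> 0 < derive1 inst_freq eta) \/
    (forall eta, I eta -> derive1 inst_freq eta < 0).
  have b2 : 0 < 2 * b by rewrite mulr_gt0.
  case: J_sign => sgn; [left|right] => eta /I_regular[w0 /sgn Js];
    rewrite derive1_inst_freq// /freq_rate -mulrA.
    by rewrite oppr_gt0 pmulr_rlt0.
  by rewrite oppr_lt0 pmulr_rgt0.
have cG s : J s -> {for s, continuous G}.
  move=> Js; apply: cvgM; first exact: continuous_density_J.
  exact: continuous_gauss_kernel.
have S := @integral_substitution R inst_freq freq_inv c d I J c_noninc d_nondec cd I_exh
  J_itv FI KJ dF cdF monoF G cG.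
rewrite /Rintegral S; congr fine; apply: eq_integral => eta /set_mem Ieta.
have [w0 _] := I_regular Ieta.
rewrite derive1_inst_freq// /sst_profile.
rewrite -(density_inst_freq b_gt0 a_gt0 lt_xi01 eps2 w0) /G.
by congr (_%:E); exact: mulrAC.
Qed.

(** The transform restricted to a branch whose image contains xi. *)
Lemma sst_piece_smoothing xi : J xi -> exists K : R, forall alpha, 0 < alpha ->
  `|\int[mu]_(eta in I) sst_profile alpha xi eta - density xi| <= K * alpha.
Proof.
move=> Jxi; have [r _] := J_regular Jxi.
have [C C0 bC] := density_bounded b_gt0 a_gt0 lt_xi01 eps2.
have [l [C2 near2]] := density_second_order b_gt0 a_gt0 lt_xi01 eps2 r.
have bJ s : J s -> `|density s| <= C by move=> /J_regular[rs _]; exact: bC.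
have nJ : \forall s \near xi, J s /\
    `|density s - density xi - l * (s - xi)| <= C2 * (s - xi) ^+ 2.
  near=> s; split; last by near: s.
  by near: s; exact: open_nbhs_nbhs.
have [K HK] := @gauss_kernel_smoothing _ J density C mJ mdensity C0 bJ xi l C2 Jxi nJ.
by exists K => alpha a0; rewrite sst_piece// HK.
Unshelve. all: end_near. Qed.

(** The transform restricted to a branch whose image stays away from xi. *)
Lemma sst_piece_tail xi p q :
  (forall s, J s -> q + (s - p) ^+ 2 <= (s - xi) ^+ 2) ->
  exists2 C : R, 0 <= C & forall alpha, 0 < alpha ->
    `|\int[mu]_(eta in I) sst_profile alpha xi eta| <= C * expR (- (q / alpha)).
Proof.
move=> far; have [C C0 bC] := density_bounded b_gt0 a_gt0 lt_xi01 eps2.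
exists C => // alpha a0; rewrite sst_piece//.
apply: (@gauss_kernel_tail _ J density C mJ mdensity C0 _ xi p q far) => //.
by move=> s /J_regular[rs _]; exact: bC.
Qed.

End piece.

End reassigned_mass.

(** * Times at which the two tones are in phase or in opposition *)

Section aligned_tones.
Variables (R : realType) (sigma a xi0 xi1 eps t : R).
Hypotheses (sigma_gt0 : 0 < sigma) (a_gt0 : 0 < a) (lt_xi01 : xi0 < xi1).
Hypothesis eps2 : eps ^+ 2 = 1.
Hypothesis aligned : expi (2 * pi * xi1 * t) = eps%:C * expi (2 * pi * xi0 * t).

Local Notation mu := (@lebesgue_measure R).
Local Notation b := (pi ^+ 2 * sigma ^+ 2).
Local Notation V := (two_tone_stft sigma a xi0 xi1).
Local Notation carrier := (expi (2 * pi * xi0 * t)).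
Local Notation weight := (weight b a xi0 xi1 eps).
Local Notation inst_freq := (inst_freq b a xi0 xi1 eps).
Local Notation freq_rate := (freq_rate b a xi0 xi1 eps).
Local Notation freq_inv := (freq_inv b a xi0 xi1 eps).
Local Notation density := (density b a xi0 xi1 eps).
Local Notation tone_ratio := (tone_ratio b a xi0 xi1).
Local Notation sst_profile := (sst_profile b a xi0 xi1 eps).
Local Notation regular s := (0 < - (eps * u_star xi0 xi1 s)).

Let b_gt0 : 0 < b.
Proof. by rewrite mulr_gt0 ?exprn_gt0 ?pi_gt0. Qed.

Lemma normc_expi (x : R) : ComplexField.Normc.normc (expi x) = 1.
Proof. by rewrite /ComplexField.Normc.normc /expi cos2Dsin2 sqrtr1. Qed.

Lemma normc_real (x : R) : ComplexField.Normc.normc x%:C = `|x|.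
Proof. by rewrite /ComplexField.Normc.normc/= expr0n/= addr0 sqrtr_sqr. Qed.

Lemma expi_neq0 (x : R) : expi x != 0.
Proof.
apply/eqP => e0; have := normc_expi x.
by rewrite e0 ComplexField.Normc.normc0 => /eqP; rewrite eq_sym oner_eq0.
Qed.

Lemma stft_aligned eta :
  V t eta = carrier * (tone_profile b xi0 eta * weight eta)%:C.
Proof.
rewrite two_tone_stftE// aligned (@tone_ratioE R b a xi0 xi1) /weight.
by rewrite !(rmorphM, rmorphD, rmorph1)/=; ring.
Qed.

Lemma stft_aligned_eq0 eta : (V t eta == 0) = (weight eta == 0).
Proof.
rewrite stft_aligned mulf_eq0 (negPf (expi_neq0 _))/= eq_complex/= eqxx andbT.
by rewrite mulf_eq0 gt_eqF ?expR_gt0.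
Qed.

(** Differentiating in time multiplies the tone of frequency xi by 2 pi i xi. *)
Lemma stft_time_derive eta : cderive (V ^~ eta) t =
  (2 * pi)%:C * 'i * (carrier * (tone_profile b xi0 eta *
     (xi0 + eps * tone_ratio eta * xi1))%:C).
Proof.
set A := tone_profile b xi0 eta.
set B := a * tone_profile b xi1 eta.
have dRe : is_derive t (1 : R) (fun s => complex.Re (V s eta))
   (- (2 * pi * xi0 * A * sin (2 * pi * xi0 * t) + 2 * pi * xi1 * B * sin (2 * pi * xi1 * t))).
  have -> : (fun s => complex.Re (V s eta)) =
     (fun s => cos (2 * pi * xi0 * s) * A + cos (2 * pi * xi1 * s) * B).
    by apply/funext => s; rewrite two_tone_stftE//= -/A -/B; ring.
  apply: is_derive_eq; rewrite /GRing.scale/=; move: pi A B => p A B.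
  ring.
have dIm : is_derive t (1 : R) (fun s => complex.Im (V s eta))
   (2 * pi * xi0 * A * cos (2 * pi * xi0 * t) + 2 * pi * xi1 * B * cos (2 * pi * xi1 * t)).
  have -> : (fun s => complex.Im (V s eta)) =
     (fun s => sin (2 * pi * xi0 * s) * A + sin (2 * pi * xi1 * s) * B).
    by apply/funext => s; rewrite two_tone_stftE//= -/A -/B; ring.
  clear dRe; apply: is_derive_eq; rewrite /GRing.scale/=; move: pi A B => p A B.
  ring.
have [c1 s1] : cos (2 * pi * xi1 * t) = eps * cos (2 * pi * xi0 * t) /\
    sin (2 * pi * xi1 * t) = eps * sin (2 * pi * xi0 * t).
  move: aligned => /eqP; rewrite /expi eq_complex/= => /andP[/eqP -> /eqP ->].
  by rewrite !mul0r addr0 subr0.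
rewrite /cderive !derive1E !derive_val c1 s1 /B (@tone_ratioE R b a xi0 xi1) -/A.
rewrite /expi; apply/eqP; rewrite eq_complex/=; move: pi (tone_ratio eta) => p r.
by apply/andP; split; apply/eqP; ring.
Qed.

(** The identity also holds where the transform vanishes, since both quotients are then
    divisions by 0; so it can be differentiated in eta without side conditions. *)
Lemma reassign_quot_aligned eta : reassign_quot V t eta = (inst_freq eta)%:C.
Proof.
rewrite /reassign_quot stft_time_derive.
have i0 : (2 * pi)%:C * 'i != 0 :> R[i].
  rewrite mulf_neq0//; last by rewrite eq_complex/= oner_eq0 andbF.
  by rewrite eq_complex/= eqxx andbT mulf_neq0// gt_eqF ?pi_gt0.
rewrite stft_aligned -(mulrA ((2 * pi)%:C * 'i)) mulKf//.
have c0 := expi_neq0 (2 * pi * xi0 * t).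
rewrite -mulf_div divff// mul1r.
have A0 : (tone_profile b xi0 eta)%:C != 0 :> R[i].
  by rewrite eq_complex/= eqxx andbT gt_eqF ?expR_gt0.
by rewrite 2!rmorphM/= -mulf_div divff// mul1r /inst_freq fmorph_div.
Qed.

Lemma reassign_aligned eta :
  reassign V t eta = if weight eta != 0 then Some (inst_freq eta)%:C else None.
Proof. by rewrite /reassign stft_aligned_eq0 reassign_quot_aligned. Qed.

Lemma reassign_fiber_sub eta xi : reassign_fiber V t xi eta ->
  [/\ weight eta != 0, inst_freq eta = xi & regular xi].
Proof.
rewrite /reassign_fiber/= reassign_aligned; case: ifP => // w0 [fx].
by split => //; rewrite -fx; exact: inst_freq_reg.
Qed.

Lemma reassign_fiberE xi :
  reassign_fiber V t xi = if regular xi then [set freq_inv xi] else set0.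
Proof.
apply/seteqP; split => eta.
  by move=> /reassign_fiber_sub[w0 <- r]; rewrite r/= freq_inv_inst_freq.
case: ifPn => [r ->|_ []]; rewrite /reassign_fiber/= reassign_aligned.
by rewrite weight_freq_inv_neq0// inst_freq_freq_inv.
Qed.

Lemma is_derive_reassign_quot eta : weight eta != 0 ->
  cderivable (reassign_quot V t) eta /\
  cderive (reassign_quot V t) eta = (freq_rate eta)%:C.
Proof.
move=> w0; have dF := is_derive_inst_freq w0.
have ReE : (fun y => complex.Re (reassign_quot V t y)) = inst_freq.
  by apply/funext => y; rewrite reassign_quot_aligned.
have ImE : (fun y => complex.Im (reassign_quot V t y)) = cst 0.
  by apply/funext => y; rewrite reassign_quot_aligned.
rewrite /cderivable /cderive ReE ImE; split; first by split.
by rewrite !derive1E derive_cst derive_val.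
Qed.

Lemma regular_value_aligned xi : regular_value V t xi.
Proof.
split.
  by rewrite reassign_fiberE; case: ifPn => _; [exact: finite_set1|exact: finite_set0].
move=> eta /reassign_fiber_sub[w0 _ _].
have [? ->] := is_derive_reassign_quot w0; split => //.
by rewrite eq_complex/= eqxx andbT freq_rate_neq0.
Qed.

Lemma pushforward_density_aligned xi :
  pushforward_density V t xi = if regular xi then carrier * (density xi)%:C else 0.
Proof.
rewrite /pushforward_density reassign_fiberE; case: ifPn => r; last by rewrite fsbig_set0.
rewrite fsbig_set1.
have w0 := weight_freq_inv_neq0 b_gt0 a_gt0 lt_xi01 eps2 r.
have [_ ->] := is_derive_reassign_quot w0.
rewrite normc_real stft_aligned -mulrA -fmorph_div; congr (_ * _%:C).
have := density_inst_freq b_gt0 a_gt0 lt_xi01 eps2 w0.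
rewrite inst_freq_freq_inv// => <-; rewrite mulfK// normr_eq0.
exact: freq_rate_neq0.
Qed.

(** At a zero of the transform the mollifier is replaced by 0 while the product with the
    transform vanishes anyway, so no exceptional set appears in the integral. *)
Lemma sst_aligned alpha xi : 0 < alpha ->
  sst V alpha t xi = carrier *
    (\int[mu]_eta sst_profile alpha xi eta)%:C.
Proof.
move=> a0; rewrite /sst.
have E eta : V t eta * (mollifier_at alpha (reassign V t eta) xi)%:C =
    carrier * (sst_profile alpha xi eta)%:C.
  rewrite stft_aligned reassign_aligned.
  rewrite -mulrA -rmorphM/= /sst_profile.
  case: ifPn => [w0|]; last by rewrite negbK => /eqP ->; rewrite !(mulr0, mul0r).
  have normB (x y : R) : ComplexField.Normc.normc (x%:C - y%:C) = `|x - y|.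
    by rewrite -normc_real rmorphB.
  by rewrite /mollifier_at /mollifier normB real_normK ?num_real.
have int := @integrable_sst_profile R b a xi0 xi1 eps b_gt0 a_gt0 eps2 alpha xi a0.
rewrite /cintegral.
have -> : \int[mu]_x complex.Re (V t x * (mollifier_at alpha (reassign V t x) xi)%:C) =
    \int[mu]_x (cos (2 * pi * xi0 * t) * sst_profile alpha xi x).
  by apply: eq_Rintegral => x _; rewrite E /expi;
    move: (sst_profile _ _ _) => y /=; rewrite mulr0 subr0.
have -> : \int[mu]_x complex.Im (V t x * (mollifier_at alpha (reassign V t x) xi)%:C) =
    \int[mu]_x (sin (2 * pi * xi0 * t) * sst_profile alpha xi x).
  by apply: eq_Rintegral => x _; rewrite E /expi;
    move: (sst_profile _ _ _) => y /=; rewrite mulr0 add0r.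
rewrite !RintegralZl// /expi; apply/eqP; rewrite eq_complex/=.
by rewrite !mulr0 subr0 add0r !eqxx.
Qed.

End aligned_tones.

(** * Monotone branches of the instantaneous frequency *)

Section pieces.
Variables (R : realType) (b a xi0 xi1 : R).
Hypotheses (b_gt0 : 0 < b) (a_gt0 : 0 < a) (lt_xi01 : xi0 < xi1).

Local Notation mu := (@lebesgue_measure R).
Local Notation D := (xi1 - xi0).
Local Notation ratio := (tone_ratio b a xi0 xi1).
Local Notation u := (u_star xi0 xi1).

Let one2 : (1 : R) ^+ 2 = 1. Proof. by rewrite expr1n. Qed.

Let mone2 : (- 1 : R) ^+ 2 = 1. Proof. by rewrite sqrrN expr1n. Qed.

Let D0 : 0 < D. Proof. by rewrite subr_gt0. Qed.

(** The frequency where both tones have the same modulus; in opposition the transform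
    vanishes there. *)
Let balance : R := (xi0 + xi1) / 2 - ln a / (2 * b * D).

Let tone_ratio_balance : ratio balance = 1.
Proof.
rewrite /tone_ratio /balance.
have -> : 2 * b * D * ((xi0 + xi1) / 2 - ln a / (2 * b * D) - (xi0 + xi1) / 2) = - ln a.
  by field; rewrite !gt_eqF.
by rewrite expRN lnK ?posrE// divff// gt_eqF.
Qed.

Let ltr_tone_ratio x y : (ratio x < ratio y) = (x < y).
Proof.
rewrite /tone_ratio ltr_pM2l// ltr_expR ltr_pM2l ?ltrD2r//.
by rewrite !mulr_gt0.
Qed.

Let tone_ratio_lt1 x : (ratio x < 1) = (x < balance).
Proof. by rewrite -tone_ratio_balance ltr_tone_ratio. Qed.

Let tone_ratio_gt1 x : (1 < ratio x) = (balance < x).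
Proof. by rewrite -tone_ratio_balance ltr_tone_ratio. Qed.

Let J0 : set R := `]xi0, xi1[%classic.

Let Jlow : set R := `]-oo, xi0[%classic.

Let Jhigh : set R := `]xi1, +oo[%classic.

Let Ilow : set R := `]-oo, balance[%classic.

Let Ihigh : set R := `]balance, +oo[%classic.

Let regular_mid s : J0 s -> 0 < - (1 * u s).
Proof.
rewrite /J0/= in_itv/= => /andP[s0 s1].
by rewrite mul1r oppr_gt0 /u_star pmulr_rlt0 ?subr_gt0// invr_lt0 subr_lt0.
Qed.

Let regular_low s : Jlow s -> 0 < - (- 1 * u s).
Proof.
rewrite /Jlow/= in_itv/= => s0.
rewrite mulN1r opprK /u_star nmulr_rgt0 ?subr_lt0// invr_lt0 subr_lt0.
exact: lt_trans lt_xi01.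
Qed.

Let regular_high s : Jhigh s -> 0 < - (- 1 * u s).
Proof.
rewrite /Jhigh/= in_itv/= andbT => s1.
rewrite mulN1r opprK /u_star pmulr_rgt0 ?invr_gt0 ?subr_gt0//.
exact: lt_trans s1.
Qed.

Let exh_mid : [set: R] = \bigcup_n `[- n.+1%:R, n.+1%:R]%classic.
Proof.
apply/seteqP; split => // x _; have [n xn] := normr_le_nat x.
exists n => //=; rewrite in_itv/= -ler_norml (le_trans xn)//.
by rewrite ler_nat.
Qed.

(** One index n serves both ends of the exhausting segments of a half-line. *)
Let scale (y : R) : 0 < y -> exists n : nat, n.+1%:R^-1 <= y <= n.+2%:R.
Proof.
move=> y0; have [n yn] := normr_le_nat (y + y^-1).
have yi : 0 < y^-1 by rewrite invr_gt0.
rewrite ger0_norm in yn; last by rewrite addr_ge0 ?ltW.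
have n1 : (n%:R : R) <= n.+1%:R by rewrite ler_nat.
have n2 : (n%:R : R) <= n.+2%:R by rewrite ler_nat ltnW.
exists n; apply/andP; split; last by lra.
by rewrite -[leRHS]invrK lef_pV2 ?posrE ?invr_gt0//; lra.
Qed.

Let exh_low : Ilow =
  \bigcup_n `[balance - n.+2%:R, balance - n.+1%:R^-1]%classic.
Proof.
rewrite /Ilow; apply/seteqP; split => [x|x [n _]] /=; rewrite !in_itv/=.
  rewrite -subr_gt0 => /scale[n /andP[n1 n2]]; exists n => //=.
  by rewrite in_itv/= lerBlDr -lerBlDl n2 lerBrDr -lerBrDl n1.
by move=> /andP[_ xn]; rewrite (le_lt_trans xn)// ltrBlDr ltrDl invr_gt0.
Qed.

Let exh_high : Ihigh =
  \bigcup_n `[balance + n.+1%:R^-1, balance + n.+2%:R]%classic.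
Proof.
rewrite /Ihigh; apply/seteqP; split => [x|x [n _]] /=; rewrite !in_itv/= ?andbT.
  rewrite -subr_gt0 => /scale[n /andP[n1 n2]]; exists n => //=.
  by rewrite in_itv/= -lerBrDl n1 -lerBlDl n2.
by move=> /andP[xn _]; rewrite (lt_le_trans _ xn)// ltrDl invr_gt0.
Qed.

Let invS_lt (n : nat) : (n.+1%:R^-1 : R) < n.+2%:R.
Proof. by rewrite (@le_lt_trans _ _ 1) ?invf_le1 ?ltr1n ?ler1n. Qed.

Let noninc_invS (n m : nat) : (n <= m)%N -> (m.+1%:R^-1 : R) <= n.+1%:R^-1.
Proof. by move=> nm; rewrite lef_pV2 ?posrE// ler_nat ltnS. Qed.

Let nondec_S (n m : nat) : (n <= m)%N -> (n.+2%:R : R) <= m.+2%:R.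
Proof. by move=> nm; rewrite ler_nat !ltnS. Qed.

Local Notation profile eps := (sst_profile b a xi0 xi1 eps).
Local Notation density eps := (density b a xi0 xi1 eps).
Local Notation inst_freq eps := (inst_freq b a xi0 xi1 eps).
Local Notation freq_inv eps := (freq_inv b a xi0 xi1 eps).
Local Notation wt eps := (weight b a xi0 xi1 eps).

Let I_mid eta : [set: R] eta -> wt 1 eta != 0 /\ J0 (inst_freq 1 eta).
Proof.
move=> _; have r0 := tone_ratio_gt0 b xi0 xi1 a_gt0 eta.
have w0 : 0 < wt 1 eta by rewrite /weight mul1r addr_gt0.
have wn0 : wt 1 eta != 0 by rewrite gt_eqF.
split=> //; rewrite /J0/= in_itv/=; apply/andP; split.
  by rewrite -subr_gt0 inst_freqB0// mul1r divr_gt0// mulr_gt0.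
by rewrite -subr_lt0 inst_freqB1// oppr_lt0 divr_gt0.
Qed.

Let J_mid s : J0 s -> 0 < - (1 * u s) /\ [set: R] (freq_inv 1 s).
Proof. by move=> /regular_mid. Qed.

Let I_low eta : Ilow eta -> wt (- 1) eta != 0 /\ Jlow (inst_freq (- 1) eta).
Proof.
rewrite /Ilow/= in_itv/= -tone_ratio_lt1 => r1.
have r0 := tone_ratio_gt0 b xi0 xi1 a_gt0 eta.
have w0 : 0 < wt (- 1) eta by rewrite /weight mulN1r subr_gt0.
have wn0 : wt (- 1) eta != 0 by rewrite gt_eqF.
split=> //; rewrite /Jlow/= in_itv/=.
by rewrite -subr_lt0 inst_freqB0// mulN1r !mulNr oppr_lt0 divr_gt0// mulr_gt0.
Qed.

Let J_low s : Jlow s -> 0 < - (- 1 * u s) /\ Ilow (freq_inv (- 1) s).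
Proof.
move=> Js; have r := regular_low Js; split => //.
rewrite /Ilow/= in_itv/= -tone_ratio_lt1 tone_ratio_freq_inv// mulN1r opprK.
rewrite -subr_gt0 (one_minus_u r) oppr_gt0 pmulr_rlt0// invr_lt0 subr_lt0.
by move: Js; rewrite /Jlow/= in_itv/= => /lt_trans; apply.
Qed.

Let I_high eta : Ihigh eta -> wt (- 1) eta != 0 /\ Jhigh (inst_freq (- 1) eta).
Proof.
rewrite /Ihigh/= in_itv/= andbT -tone_ratio_gt1 => r1.
have w0 : wt (- 1) eta < 0 by rewrite /weight mulN1r subr_lt0.
have wn0 : wt (- 1) eta != 0 by rewrite lt_eqF.
split=> //; rewrite /Jhigh/= in_itv/= andbT.
by rewrite -subr_gt0 inst_freqB1// oppr_gt0 pmulr_rlt0// invr_lt0.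
Qed.

Let J_high s : Jhigh s -> 0 < - (- 1 * u s) /\ Ihigh (freq_inv (- 1) s).
Proof.
move=> Js; have r := regular_high Js; split => //.
rewrite /Ihigh/= in_itv/= andbT -tone_ratio_gt1 tone_ratio_freq_inv// mulN1r opprK.
rewrite -subr_lt0 (one_minus_u r) oppr_lt0 divr_gt0// subr_gt0.
by move: Js; rewrite /Jhigh/= in_itv/= andbT.
Qed.

Let sign_mid s : J0 s -> (s - xi0) * (s - xi1) < 0.
Proof.
by rewrite /J0/= in_itv/= => /andP[s0 s1]; rewrite pmulr_rlt0 ?subr_gt0// subr_lt0.
Qed.

Let sign_low s : Jlow s -> 0 < (s - xi0) * (s - xi1).
Proof.
rewrite /Jlow/= in_itv/= => s0; rewrite nmulr_rgt0 ?subr_lt0//.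
exact: lt_trans lt_xi01.
Qed.

Let sign_high s : Jhigh s -> 0 < (s - xi0) * (s - xi1).
Proof.
rewrite /Jhigh/= in_itv/= andbT => s1; rewrite pmulr_rgt0 ?subr_gt0//.
exact: lt_trans s1.
Qed.

Let c0_noninc (n m : nat) : (n <= m)%N -> (- m.+1%:R : R) <= - n.+1%:R.
Proof. by move=> nm; rewrite lerN2 ler_nat ltnS. Qed.

Let d0_nondec (n m : nat) : (n <= m)%N -> (n.+1%:R : R) <= m.+1%:R.
Proof. by move=> nm; rewrite ler_nat ltnS. Qed.

Let cd0 (n : nat) : (- n.+1%:R : R) < n.+1%:R.
Proof. by rewrite (@lt_trans _ _ 0) ?oppr_lt0. Qed.

Let cl_noninc (n m : nat) : (n <= m)%N -> balance - m.+2%:R <= balance - n.+2%:R.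
Proof. by move=> nm; rewrite lerD2l lerN2 nondec_S. Qed.

Let dl_nondec (n m : nat) : (n <= m)%N ->
  balance - n.+1%:R^-1 <= balance - m.+1%:R^-1.
Proof. by move=> nm; rewrite lerD2l lerN2 noninc_invS. Qed.

Let cdl (n : nat) : balance - n.+2%:R < balance - n.+1%:R^-1.
Proof. by rewrite ltrD2l ltrN2 invS_lt. Qed.

Let ch_noninc (n m : nat) : (n <= m)%N ->
  balance + m.+1%:R^-1 <= balance + n.+1%:R^-1.
Proof. by move=> nm; rewrite lerD2l noninc_invS. Qed.

Let dh_nondec (n m : nat) : (n <= m)%N -> balance + n.+2%:R <= balance + m.+2%:R.
Proof. by move=> nm; rewrite lerD2l nondec_S. Qed.

Let cdh (n : nat) : balance + n.+1%:R^-1 < balance + n.+2%:R.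
Proof. by rewrite ltrD2l invS_lt. Qed.

Let itv_mid : is_interval J0. Proof. exact: interval_is_interval. Qed.

Let itv_low : is_interval Jlow. Proof. exact: interval_is_interval. Qed.

Let itv_high : is_interval Jhigh. Proof. exact: interval_is_interval. Qed.

Let open_mid : open J0. Proof. exact: interval_open. Qed.

Let open_low : open Jlow. Proof. exact: interval_open. Qed.

Let open_high : open Jhigh. Proof. exact: interval_open. Qed.

Lemma mid_smoothing xi : xi0 < xi < xi1 -> exists K : R, forall alpha, 0 < alpha ->
  `|\int[mu]_eta profile 1 alpha xi eta - density 1 xi| <= K * alpha.
Proof.
move=> xi01; apply: (sst_piece_smoothing b_gt0 a_gt0 lt_xi01 one2 c0_noninc d0_nondec
  cd0 exh_mid itv_mid open_mid I_mid J_mid (or_introl sign_mid)).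
by rewrite /J0/= in_itv.
Qed.

Let mid_tail xi p q :
  (forall s, xi0 < s < xi1 -> q + (s - p) ^+ 2 <= (s - xi) ^+ 2) ->
  exists2 C : R, 0 <= C & forall alpha, 0 < alpha ->
    `|\int[mu]_eta profile 1 alpha xi eta| <= C * expR (- (q / alpha)).
Proof.
move=> far; apply: (sst_piece_tail b_gt0 a_gt0 lt_xi01 one2 c0_noninc d0_nondec
  cd0 exh_mid itv_mid open_mid I_mid J_mid (or_introl sign_mid) (p := p)).
by move=> s; rewrite /J0/= in_itv/=; exact: far.
Qed.

Let low_smoothing xi : xi < xi0 -> exists K : R, forall alpha, 0 < alpha ->
  `|\int[mu]_(eta in Ilow) profile (- 1) alpha xi eta - density (- 1) xi| <= K * alpha.
Proof.
move=> xi01; apply: (sst_piece_smoothing b_gt0 a_gt0 lt_xi01 mone2 cl_noninc dl_nondec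
  cdl exh_low itv_low open_low I_low J_low (or_intror sign_low)).
by rewrite /Jlow/= in_itv.
Qed.

Let low_tail xi p q :
  (forall s, s < xi0 -> q + (s - p) ^+ 2 <= (s - xi) ^+ 2) ->
  exists2 C : R, 0 <= C & forall alpha, 0 < alpha ->
    `|\int[mu]_(eta in Ilow) profile (- 1) alpha xi eta| <= C * expR (- (q / alpha)).
Proof.
move=> far; apply: (sst_piece_tail b_gt0 a_gt0 lt_xi01 mone2 cl_noninc dl_nondec
  cdl exh_low itv_low open_low I_low J_low (or_intror sign_low) (p := p)).
by move=> s; rewrite /Jlow/= in_itv/=; exact: far.
Qed.

Let high_smoothing xi : xi1 < xi -> exists K : R, forall alpha, 0 < alpha ->
  `|\int[mu]_(eta in Ihigh) profile (- 1) alpha xi eta - density (- 1) xi| <= K * alpha.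
Proof.
move=> xi01; apply: (sst_piece_smoothing b_gt0 a_gt0 lt_xi01 mone2 ch_noninc dh_nondec
  cdh exh_high itv_high open_high I_high J_high (or_intror sign_high)).
by rewrite /Jhigh/= in_itv/= andbT.
Qed.

Let high_tail xi p q :
  (forall s, xi1 < s -> q + (s - p) ^+ 2 <= (s - xi) ^+ 2) ->
  exists2 C : R, 0 <= C & forall alpha, 0 < alpha ->
    `|\int[mu]_(eta in Ihigh) profile (- 1) alpha xi eta| <= C * expR (- (q / alpha)).
Proof.
move=> far; apply: (sst_piece_tail b_gt0 a_gt0 lt_xi01 mone2 ch_noninc dh_nondec
  cdh exh_high itv_high open_high I_high J_high (or_intror sign_high) (p := p)).
by move=> s; rewrite /Jhigh/= in_itv/= andbT; exact: far.
Qed.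

Let split_low_high alpha xi : 0 < alpha ->
  \int[mu]_eta profile (- 1) alpha xi eta =
  \int[mu]_(eta in Ilow) profile (- 1) alpha xi eta +
  \int[mu]_(eta in Ihigh) profile (- 1) alpha xi eta.
Proof.
move=> a0; have int := @integrable_sst_profile R b a xi0 xi1 (- 1) b_gt0 a_gt0 mone2 alpha xi a0.
have intS A : measurable A -> mu.-integrable A (EFin \o profile (- 1) alpha xi).
  by move=> mA; exact: integrableS int.
have mid0 : [set: R] = Ilow `|` `[balance, +oo[%classic.
  apply/seteqP; split => // x _; rewrite /Ilow/= !in_itv/= andbT.
  by have [|] := ltP x balance; [left|right].
have dis : [disjoint Ilow & `[balance, +oo[%classic].
  rewrite disj_set2E; apply/eqP/seteqP; split => // x; rewrite /Ilow /= !in_itv/= andbT.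
  by move=> [x1 x2]; move: (lt_le_trans x1 x2); rewrite ltxx.
have mU : measurable (Ilow `|` `[balance, +oo[%classic) by rewrite -mid0.
have -> : \int[mu]_(eta in Ihigh) profile (- 1) alpha xi eta =
    \int[mu]_(eta in `[balance, +oo[) profile (- 1) alpha xi eta.
  by rewrite /Ihigh Rintegral_itv_obnd_cbnd//; exact: intS.
rewrite mid0 (Rintegral_setU _ _ (intS _ mU) dis) //; exact: measurable_itv.
Qed.

Let expR_dist_le (xi q alpha : R) : M_dist xi0 xi1 xi <= q -> 0 < alpha ->
  expR (- (q / alpha)) <= expR (- (M_dist xi0 xi1 xi / alpha)).
Proof. by move=> Mq a0; rewrite ler_expR lerN2 ler_wpM2r ?invr_ge0// ltW. Qed.

(** From exp y >= y at y = q / alpha. *)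
Let expR_le_linear (q alpha : R) : 0 < q -> 0 < alpha -> expR (- (q / alpha)) <= q^-1 * alpha.
Proof.
move=> q0 a0; have y0 : 0 < q / alpha by rewrite divr_gt0.
rewrite expRN -[leRHS]invrK lef_pV2 ?posrE ?expR_gt0 ?invr_gt0 ?mulr_gt0 ?invr_gt0//.
rewrite invfM invrK (le_trans _ (expR_ge1Dx _))//.
by rewrite lerDr.
Qed.

Lemma mid_outside xi : xi < xi0 \/ xi1 < xi ->
  exists2 C : R, 0 <= C & forall alpha, 0 < alpha ->
    `|\int[mu]_eta profile 1 alpha xi eta| <= C * expR (- (M_dist xi0 xi1 xi / alpha)).
Proof.
case=> out.
  have [|C C0 HC] := @mid_tail xi xi0 ((xi - xi0) ^+ 2).
    move=> s /andP[s0 s1].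
    (* The cross term of (s - xi)^2 = ((s - xi0) + (xi0 - xi))^2 is nonnegative. *)
    have h : 0 <= (s - xi0) * (xi0 - xi) by rewrite mulr_ge0// subr_ge0 ltW.
    by nra.
  exists C => // alpha a0; rewrite (le_trans (HC _ a0))// ler_wpM2l//.
  by apply: expR_dist_le => //; rewrite ge_min lexx.
have [|C C0 HC] := @mid_tail xi xi1 ((xi - xi1) ^+ 2).
  move=> s /andP[s0 s1].
  have h : 0 <= (xi1 - s) * (xi - xi1) by rewrite mulr_ge0// subr_ge0 ltW.
  by nra.
exists C => // alpha a0; rewrite (le_trans (HC _ a0))// ler_wpM2l//.
by apply: expR_dist_le => //; rewrite ge_min lexx orbT.
Qed.

Let low_far xi : xi0 < xi -> forall s, s < xi0 ->
  (xi - xi0) ^+ 2 + (s - xi0) ^+ 2 <= (s - xi) ^+ 2.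
Proof.
move=> x0 s s0; have h : 0 <= (xi0 - s) * (xi - xi0) by rewrite mulr_ge0// subr_ge0 ltW.
by nra.
Qed.

Let high_far xi : xi < xi1 -> forall s, xi1 < s ->
  (xi - xi1) ^+ 2 + (s - xi1) ^+ 2 <= (s - xi) ^+ 2.
Proof.
move=> x1 s s1; have h : 0 <= (s - xi1) * (xi1 - xi) by rewrite mulr_ge0// subr_ge0 ltW.
by nra.
Qed.

Lemma split_inside xi : xi0 < xi < xi1 ->
  exists2 C : R, 0 <= C & forall alpha, 0 < alpha ->
    `|\int[mu]_eta profile (- 1) alpha xi eta| <=
    C * expR (- (M_dist xi0 xi1 xi / alpha)).
Proof.
move=> /andP[x0 x1].
have [C1 C10 H1] := low_tail (low_far x0).
have [C2 C20 H2] := high_tail (high_far x1).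
exists (C1 + C2); first exact: addr_ge0.
move=> alpha a0; rewrite split_low_high// (le_trans (ler_normD _ _))// mulrDl lerD//.
  rewrite (le_trans (H1 _ a0))// ler_wpM2l//.
  by apply: expR_dist_le => //; rewrite ge_min lexx.
rewrite (le_trans (H2 _ a0))// ler_wpM2l//.
by apply: expR_dist_le => //; rewrite ge_min lexx orbT.
Qed.

(** The upper branch contributes O(exp (- (xi - xi1)^2 / alpha)), which is O(alpha). *)
Lemma split_below xi : xi < xi0 -> exists K : R, forall alpha, 0 < alpha ->
  `|\int[mu]_eta profile (- 1) alpha xi eta - density (- 1) xi| <= K * alpha.
Proof.
move=> x0; have x1 : xi < xi1 by exact: lt_trans lt_xi01.
have [K HK] := low_smoothing x0.
have [C C0 HC] := high_tail (high_far x1).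
have q0 : 0 < (xi - xi1) ^+ 2 by rewrite exprn_even_gt0//= subr_eq0 lt_eqF.
exists (K + C * ((xi - xi1) ^+ 2)^-1) => alpha a0; rewrite split_low_high// addrAC.
rewrite (le_trans (ler_normD _ _))// mulrDl lerD ?HK//.
by rewrite (le_trans (HC _ a0))// -mulrA ler_wpM2l// expR_le_linear.
Qed.

Lemma split_above xi : xi1 < xi -> exists K : R, forall alpha, 0 < alpha ->
  `|\int[mu]_eta profile (- 1) alpha xi eta - density (- 1) xi| <= K * alpha.
Proof.
move=> x1; have x0 : xi0 < xi by exact: lt_trans x1.
have [K HK] := high_smoothing x1.
have [C C0 HC] := low_tail (low_far x0).
have q0 : 0 < (xi - xi0) ^+ 2 by rewrite exprn_even_gt0//= subr_eq0 gt_eqF.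
exists (K + C * ((xi - xi0) ^+ 2)^-1) => alpha a0; rewrite split_low_high//.
rewrite [X in X - _]addrC addrAC (le_trans (ler_normD _ _))// mulrDl lerD ?HK//.
by rewrite (le_trans (HC _ a0))// -mulrA ler_wpM2l// expR_le_linear.
Qed.

Lemma regular_inside s : (0 < - (1 * u s)) = (xi0 < s < xi1).
Proof.
apply/idP/idP => [r|/andP[s0 s1]]; last by apply: regular_mid; rewrite /J0/= in_itv/= s0.
have [s0|s0|s0] := ltgtP xi0 s; last by move: (reg_neq0 r); rewrite s0 subrr eqxx.
  have [s1|s1|s1] := ltgtP s xi1 => //; last by move: (reg_neq1 r); rewrite s1 subrr eqxx.
  have := regular_high; rewrite /Jhigh/= => /(_ s); rewrite in_itv/= andbT => /(_ s1).
  by move: r; rewrite !mulNr !mul1r opprK oppr_gt0 => /lt_trans h /h; rewrite ltxx.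
have := regular_low; rewrite /Jlow/= => /(_ s); rewrite in_itv/= => /(_ s0).
by move: r; rewrite !mulNr !mul1r opprK oppr_gt0 => /lt_trans h /h; rewrite ltxx.
Qed.

Lemma regular_outside s : (0 < - (- 1 * u s)) = (s < xi0) || (xi1 < s).
Proof.
apply/idP/idP => [r|/orP[s0|s1]].
- have [//|s0/=] := ltP s xi0; have [//|s1] := ltP xi1 s.
  have n0 : s != xi0 by rewrite -subr_eq0; exact: reg_neq0 r.
  have n1 : s != xi1 by rewrite -subr_eq0; exact: reg_neq1 r.
  have : 0 < - (1 * u s) by rewrite regular_inside !lt_neqAle eq_sym n0 s0 n1.
  by move: r; rewrite !mulNr !mul1r opprK oppr_gt0 => /lt_trans h /h; rewrite ltxx.
- by apply: regular_low; rewrite /Jlow/= in_itv.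
- by apply: regular_high; rewrite /Jhigh/= in_itv/= andbT.
Qed.

End pieces.

(** * Asymptotics and closed forms *)

Section main.
Variable R : realType.

Lemma cbigO_bound (F : R -> R[i]) (G : R -> R) (C : R) :
  (forall alpha, 0 < alpha -> ComplexField.Normc.normc (F alpha) <= C * `|G alpha|) ->
  cbigO F G.
Proof.
move=> FG; rewrite /cbigO; apply/eqO_exP; exists (`|C| + 1); first by rewrite ltr_wpDl.
near=> alpha; have a0 : 0 < alpha by near: alpha; exact: nbhs_right_gt.
have n0 : 0 <= ComplexField.Normc.normc (F alpha) by case: (F alpha) => x y; exact: sqrtr_ge0.
rewrite ger0_norm// (le_trans (FG _ a0))// ler_wpM2r//.
by rewrite (le_trans (ler_norm C))// lerDl.
Unshelve. all: end_near. Qed.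

Lemma expi_2pi_nat (n : nat) : expi (2 * pi * n%:R : R) = 1.
Proof.
elim: n => [|n IHn].
  by rewrite mulr0 /expi cos0 sin0.
rewrite -[n.+1%:R]natr1 mulrDr mulr1 expiD IHn mul1r /expi.
by rewrite mulr_natl cos2pi sin2pi.
Qed.

Lemma expi_2pi_int (k : int) : expi (2 * pi * k%:~R : R) = 1.
Proof.
case: (intP k) => [|n|n]; first by rewrite mulr0 /expi cos0 sin0.
  exact: expi_2pi_nat.
have := expiD (2 * pi * (- n.+1%:Z)%:~R : R) (2 * pi * n.+1%:R).
rewrite expi_2pi_nat mulr1 => <-.
by rewrite rmorphN/= mulrN addNr /expi cos0 sin0.
Qed.

Lemma density_formE (sigma xi0 xi1 t A xi : R) :
  density_form sigma xi0 xi1 t A xi = expi (2 * pi * xi0 * t) *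
    (A / (2 * (pi ^+ 2 * sigma ^+ 2) * ((xi - xi0) * (xi - xi1))))%:C.
Proof.
rewrite /density_form -mulrA (mulrC _^-1) -fmorph_div; congr (_ * _%:C).
rewrite -(mulrA A) -invfM; congr (_ * _^-1).
by rewrite mulrC !mulrA.
Qed.

Variables (sigma a xi0 xi1 : R) (k : int).
Hypotheses (sigma_gt0 : 0 < sigma) (a_gt0 : 0 < a) (lt_xi01 : xi0 < xi1).

Let D_neq0 : xi1 - xi0 != 0. Proof. by rewrite subr_eq0 gt_eqF. Qed.

Lemma aligned_plus : expi (2 * pi * xi1 * t_plus xi0 xi1 k) =
  1%:C * expi (2 * pi * xi0 * t_plus xi0 xi1 k).
Proof.
have -> : 2 * pi * xi1 * t_plus xi0 xi1 k =
    2 * pi * k%:~R + 2 * pi * xi0 * t_plus xi0 xi1 k.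
  by rewrite /t_plus; move: pi (k%:~R) => p K; field.
by rewrite expiD expi_2pi_int.
Qed.

Lemma aligned_minus : expi (2 * pi * xi1 * t_minus xi0 xi1 k) =
  (- 1)%:C * expi (2 * pi * xi0 * t_minus xi0 xi1 k).
Proof.
have -> : 2 * pi * xi1 * t_minus xi0 xi1 k =
    2 * pi * k%:~R + pi + 2 * pi * xi0 * t_minus xi0 xi1 k.
  by rewrite /t_minus; move: pi (k%:~R) => p K; field.
rewrite expiD (expiD (2 * pi * k%:~R)) expi_2pi_int mul1r; congr (_ * _).
by rewrite /expi cospi sinpi.
Qed.

Local Notation b := (pi ^+ 2 * sigma ^+ 2).

Let b_gt0 : 0 < b. Proof. by rewrite mulr_gt0 ?exprn_gt0 ?pi_gt0. Qed.

Let one2 : (1 : R) ^+ 2 = 1. Proof. by rewrite expr1n. Qed.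

Let mone2 : (- 1 : R) ^+ 2 = 1. Proof. by rewrite sqrrN expr1n. Qed.

Lemma density_inside xi : xi0 < xi < xi1 ->
  density b a xi0 xi1 1 xi =
  - (A_plus sigma a xi0 xi1 xi / (2 * b * ((xi - xi0) * (xi - xi1)))).
Proof.
move=> xi01; have r : 0 < - (1 * u_star xi0 xi1 xi) by rewrite regular_inside.
have sgn : (xi - xi0) * (xi - xi1) < 0.
  by case/andP: xi01 => x0 x1; rewrite pmulr_rlt0 ?subr_gt0// subr_lt0.
rewrite /density tone_profile_freq_inv// ltr0_norm// mul1r /A_plus.
set u := u_star _ _ _.
have -> : - (a / u) = a / - u by rewrite invrN mulrN.
have -> : - (u / a) = - u / a by rewrite mulNr.
have -> : 4 * b * (xi1 - xi0) ^+ 2 = 4 * pi ^+ 2 * sigma ^+ 2 * (xi1 - xi0) ^+ 2.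
  by rewrite (mulrA 4).
have swap (e f g w q : R) :
    e * f * g * w / (2 * b * - q) = - (w * e * f * g / (2 * b * q)).
  by rewrite mulrN invrN mulrN; congr (- _); congr (_ / _); ring.
exact: swap.
Qed.

Lemma density_outside xi : (xi < xi0) || (xi1 < xi) ->
  density b a xi0 xi1 (- 1) xi =
  Num.sg (1 - u_star xi0 xi1 xi) *
  (A_minus sigma a xi0 xi1 xi / (2 * b * ((xi - xi0) * (xi - xi1)))).
Proof.
move=> out; have r : 0 < - (- 1 * u_star xi0 xi1 xi) by rewrite regular_outside.
have sgn : 0 < (xi - xi0) * (xi - xi1).
  case/orP: out => h.
    by rewrite nmulr_rgt0 ?subr_lt0// (lt_trans h).
  by rewrite pmulr_rgt0 ?subr_gt0// (lt_trans _ h).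
rewrite /density tone_profile_freq_inv// gtr0_norm// mulN1r opprK /A_minus.
set u := u_star _ _ _.
have -> : 4 * b * (xi1 - xi0) ^+ 2 = 4 * pi ^+ 2 * sigma ^+ 2 * (xi1 - xi0) ^+ 2.
  by rewrite (mulrA 4).
have swap (e f g w q : R) :
    e * f * g * w / q = Num.sg w * (`|w| * e * f * g / q).
  by rewrite {1}[w]numEsg; ring.
exact: swap.
Qed.

End main.

Theorem theorem3 (R : realType) (sigma a xi0 xi1 : R)
    (sigma_gt0 : 0 < sigma) (a_gt0 : 0 < a) (lt_xi01 : xi0 < xi1) (k : int) :
  let V := two_tone_stft sigma a xi0 xi1 in
  let tp := t_plus xi0 xi1 k in
  let tm := t_minus xi0 xi1 k in
  let M := M_dist xi0 xi1 in
  let Theta := pushforward_density V in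
  [/\ (* asymptotics at constructive times *)
      (forall xi : R, xi0 < xi < xi1 ->
         cbigO (fun alpha => sst V alpha tp xi - Theta tp xi)
               (fun alpha => alpha)) /\
      (forall xi : R, xi < xi0 \/ xi1 < xi ->
         cbigO (fun alpha => sst V alpha tp xi)
               (fun alpha => expR (- (M xi / alpha)))),
      (* asymptotics at destructive times *)
      (forall xi : R, xi0 < xi < xi1 ->
         cbigO (fun alpha => sst V alpha tm xi)
               (fun alpha => expR (- (M xi / alpha)))) /\
      (forall xi : R, xi < xi0 \/ xi1 < xi ->
         cbigO (fun alpha => sst V alpha tm xi - Theta tm xi)
               (fun alpha => alpha)),
      (* Theta is defined by the finite regular sum at every real xi *)
      (forall xi : R, regular_value V tp xi /\ regular_value V tm xi),
      (* closed form and support at constructive times *)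
      (forall xi : R, xi0 < xi < xi1 ->
         Theta tp xi =
           - density_form sigma xi0 xi1 tp (A_plus sigma a xi0 xi1 xi) xi) /\
      (forall xi : R, ~~ (xi0 < xi < xi1) -> Theta tp xi = 0)
    & (* closed form and support at destructive times *)
      [/\ (forall xi : R, xi < xi0 ->
             Theta tm xi =
               density_form sigma xi0 xi1 tm (A_minus sigma a xi0 xi1 xi) xi),
          (forall xi : R, xi1 < xi ->
             Theta tm xi =
               - density_form sigma xi0 xi1 tm (A_minus sigma a xi0 xi1 xi) xi)
        & (forall xi : R, xi0 <= xi <= xi1 -> Theta tm xi = 0)]].
Proof.
move=> V tp tm M Theta.
have ap := aligned_plus k lt_xi01; have am := aligned_minus k lt_xi01.
rewrite -/tp in ap; rewrite -/tm in am.
have one2 : (1 : R) ^+ 2 = 1 by rewrite expr1n.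
have mone2 : (- 1 : R) ^+ 2 = 1 by rewrite sqrrN expr1n.
have b_gt0 : 0 < pi ^+ 2 * sigma ^+ 2 :> R by rewrite mulr_gt0 ?exprn_gt0 ?pi_gt0.
have Tp xi : Theta tp xi = if xi0 < xi < xi1 then
    expi (2 * pi * xi0 * tp) * (density (pi ^+ 2 * sigma ^+ 2) a xi0 xi1 1 xi)%:C else 0.
  rewrite /Theta /V (pushforward_density_aligned sigma_gt0 a_gt0 lt_xi01 one2 ap).
  by rewrite regular_inside.
have Tm xi : Theta tm xi = if (xi < xi0) || (xi1 < xi) then
    expi (2 * pi * xi0 * tm) * (density (pi ^+ 2 * sigma ^+ 2) a xi0 xi1 (- 1) xi)%:C else 0.
  rewrite /Theta /V (pushforward_density_aligned sigma_gt0 a_gt0 lt_xi01 mone2 am).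
  by rewrite regular_outside.
have normM t (x : R) : ComplexField.Normc.normc (expi (2 * pi * xi0 * t) * x%:C) = `|x|.
  by rewrite ComplexField.Normc.normcM normc_expi mul1r normc_real.
have posn (x : R) : 0 < x -> `|x| = x by move=> x0; rewrite gtr0_norm.
have posE (x : R) : `|expR x| = expR x by rewrite ger0_norm ?expR_ge0.
split.
- split=> xi xi01.
    have [K HK] := mid_smoothing b_gt0 a_gt0 lt_xi01 xi01.
    apply: (@cbigO_bound _ _ _ K) => alpha a0; rewrite (posn _ a0).
    rewrite Tp xi01 (sst_aligned sigma_gt0 a_gt0 one2 ap)//.
    by rewrite -mulrBr -rmorphB normM HK.
  have [C C0 HC] := mid_outside b_gt0 a_gt0 lt_xi01 xi01.
  apply: (@cbigO_bound _ _ _ C) => alpha a0; rewrite posE.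
  by rewrite (sst_aligned sigma_gt0 a_gt0 one2 ap)// normM HC.
- split=> xi xi01.
    have [C C0 HC] := split_inside b_gt0 a_gt0 lt_xi01 xi01.
    apply: (@cbigO_bound _ _ _ C) => alpha a0; rewrite posE.
    by rewrite (sst_aligned sigma_gt0 a_gt0 mone2 am)// normM HC.
  have [K HK] : exists K : R, forall alpha, 0 < alpha ->
      `|\int[@lebesgue_measure R]_eta
          sst_profile (pi ^+ 2 * sigma ^+ 2) a xi0 xi1 (- 1) alpha xi eta
        - density (pi ^+ 2 * sigma ^+ 2) a xi0 xi1 (- 1) xi| <= K * alpha.
    by case: xi01 => h; [exact: split_below|exact: split_above].
  apply: (@cbigO_bound _ _ _ K) => alpha a0; rewrite (posn _ a0).
  have out : (xi < xi0) || (xi1 < xi) by apply/orP.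
  rewrite Tm out (sst_aligned sigma_gt0 a_gt0 mone2 am)//.
  by rewrite -mulrBr -rmorphB normM HK.
- move=> xi; split.
    exact: (regular_value_aligned sigma_gt0 a_gt0 lt_xi01 one2 ap).
  exact: (regular_value_aligned sigma_gt0 a_gt0 lt_xi01 mone2 am).
- split=> xi xi01; last by rewrite Tp (negPf xi01).
  by rewrite Tp xi01 density_formE density_inside// rmorphN mulrN.
- have usgn xi : (xi < xi0) || (xi1 < xi) ->
      1 - u_star xi0 xi1 xi = - ((xi1 - xi0) / (xi - xi1)).
    by rewrite -(regular_outside lt_xi01) => /one_minus_u.
  split=> xi xi01.
  + have out : (xi < xi0) || (xi1 < xi) by rewrite xi01.
    rewrite Tm out density_formE density_outside// gtr0_sg ?mul1r//.
    rewrite usgn// oppr_gt0 pmulr_rlt0 ?subr_gt0// invr_lt0 subr_lt0.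
    exact: lt_trans lt_xi01.
  + have out : (xi < xi0) || (xi1 < xi) by rewrite xi01 orbT.
    rewrite Tm out density_formE density_outside// ltr0_sg ?mulN1r ?rmorphN ?mulrN//.
    by rewrite usgn// oppr_lt0 divr_gt0// subr_gt0.
  + have out : (xi < xi0) || (xi1 < xi) = false.
      by case/andP: xi01 => h0 h1; rewrite !ltNge h0 h1.
    by rewrite Tm out.
Qed.
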